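(* Let $Y_1,Y_2$ be independent positive random variables and let $L_1,L_2,p_1,p_2$ be positive constants. Define $$A=\Bigl(\frac{p_1L_1}{p_2L_2}\Bigr)^{1/(p_1+p_2)},\qquad B=L_1A^{-p_1}+L_2A^{p_2}.$$ (a) If for $i=1,2$ $$\lim_{u\to\infty}\frac{\log \mathbb{P}(Y_i>u)}{u^{p_i}}=-L_i,$$ then $$\lim_{u\to\infty}\frac{\log\mathbb{P}(Y_1Y_2>u)}{u^{p_1p_2/(p_1+p_2)}}=-B.$$ (b) If for $i=1,2$ $$\mathbb{P}(Y_i>u)\sim g_i(u)\exp(-L_iu^{p_i}),\qquad u\to\infty,$$ where $g_1,g_2$ are functions regularly varying at infinity, then with $$c_u=Au^{p_1/(p_1+p_2)},\qquad D=\Biggl(\frac{2\pi (p_1L_1)^{\frac{p_2}{p_1+p_2}}(p_2L_2)^{\frac{p_1}{p_1+p_2}}}{p_1+p_2}\Biggr)^{1/2},$$ we have, as $u\to\infty$, $$\mathbb{P}(Y_1Y_2>u)\sim D\,u^{\frac{p_1p_2}{2(p_1+p_2)}}\,g_1(u/c_u)\,g_2(c_u)\exp\Bigl(-Bu^{\frac{p_1p_2}{p_1+p_2}}\Bigr)\sim D\,u^{\frac{p_1p_2}{2(p_1+p_2)}}\,\mathbb{P}(Y_1>u/c_u)\,\mathbb{P}(Y_2>c_u).$$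
   Context: $f_1(u)\sim f_2(u)$ means $\lim_{u\to\infty}f_1(u)/f_2(u)=1$. *)

(* Defs.v *)
From HB Require Import structures.
From mathcomp Require Import all_boot all_order all_algebra.
From mathcomp Require Import all_classical all_reals all_analysis.
Set Implicit Arguments. Unset Strict Implicit. Unset Printing Implicit Defensive.
Import Order.TTheory GRing.Theory Num.Theory.
Import numFieldNormedType.Exports.
Local Open Scope classical_set_scope.
Local Open Scope ring_scope.

Definition indep2 {d : measure_display} {T : measurableType d} {R : realType}
  (P : probability T R) (Y1 Y2 : {RV P >-> R}) : Prop :=
  forall A B : set R, measurable A -> measurable B ->
    P (Y1 @^-1` A `&` Y2 @^-1` B) = (P (Y1 @^-1` A) * P (Y2 @^-1` B))%E.

Arguments indep2 {d T R} P Y1 Y2.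

Definition tailP {d : measure_display} {T : measurableType d} {R : realType}
  (P : probability T R) (X : T -> R) (u : R) : R :=
  fine (P [set w | u < X w]).

Definition asym_equiv {R : realType} (f1 f2 : R -> R) : Prop :=
  (fun u => f1 u / f2 u) @ +oo --> (1 : R).

Definition regularly_varying {R : realType} (g : R -> R) : Prop :=
  measurable_fun setT g /\
  (exists x0 : R, forall x, x0 < x -> 0 < g x) /\
  exists alpha : R, forall t : R, 0 < t ->
    (fun x => g (t * x) / g x) @ +oo --> t `^ alpha.

(* Main.v *)
(* Put X_i = L_i Y_i^p_i, lam = p2/(p1+p2), mu = p1/(p1+p2) and s = B u^q. Then
   P(X_i > v) = e^{-v} times a regularly varying factor, and Y1 Y2 > u becomes
   (X1/lam)^lam (X2/mu)^mu > s. By the weighted arithmetic-geometric mean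
   inequality this forces X1 + X2 > s, with equality only at (lam s, mu s),
   which gives the exponential order. For the sharp order, cut the range of X2
   into cells of fixed length d centred at mu s: the cell at distance k d
   contributes, relatively to P(X1 > lam s) P(X2 > mu s), a factor
   (e^d - 1) exp(- (k d)^2 / (2 lam mu s)), because the regularly varying
   factors are asymptotically constant on the scale sqrt s (uniform convergence
   theorem) and because the convex exponent is quadratic at its minimum. The
   sum over k is a Riemann sum of the Gaussian integral; convexity and Potter's
   bounds make the remaining cells negligible. *)
Require Import Defs.
From HB Require Import structures.
From mathcomp Require Import all_boot all_order all_algebra.
From mathcomp Require Import all_classical all_reals all_analysis.
From mathcomp Require Import measurable_realfun ring lra.
Import Order.TTheory GRing.Theory Num.Theory.
Import numFieldNormedType.Exports.
Local Open Scope classical_set_scope.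
Local Open Scope ring_scope.

(** * Regular variation *)

(** Only tail functions are given, no densities, so integration against the law of Y2 is replaced by
    slabs x < Y2 <= y: independence gives their probabilities exactly and monotonicity brackets the
    event inside them. The mass of a slab is a difference of two values of T2; it is known up to a
    small relative error only if the regularly varying factor changes by much less than d across a
    cell of width d. This forces the order of limits: s to infinity with d fixed, then d to 0, with
    the error of regular variation set to d^2. The mesh of the Riemann sum is h = d / (kap sqrt s)
    with kap^2 = 2 lam mu, and (e^d - 1) / h is close to kap sqrt s; times sqrt pi this is sqrt (2
    pi lam mu s), which is D u^(q/2). The hypothesis of (a) says nothing at scale d, so there the
    cells have width s / N and their number disappears in the logarithm. In (b) the tails are only
    equivalent to regularly varying expressions; what is carried along is Potter's inequality with a
    free additive error, which survives both this equivalence and the substitution X = L Y^p. *)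

Section uniform_convergence.
Context {R : realType}.
Local Notation mu := (@lebesgue_measure R).
Implicit Types (k : R -> R) (z : nat -> R) (e : R).

(** The pushforward under the translation has the right values on the intervals []a, b]], and these
    determine the measure. *)
Lemma lebesgue_measure_shift (c : R) (A : set R) : measurable A ->
  mu ((fun x => x + c) @^-1` A) = mu A.
Proof.
have mshift : @measurable_fun _ _ (measurableTypeR R) (measurableTypeR R) setT (fun x : R => x + c).
  have : measurable_fun [set: R] (fun x : R => x + c) by apply: measurable_funD.
  exact.
move=> mA; pose f : {mfun measurableTypeR R >-> measurableTypeR R} :=
  HB.pack (fun x : R => x + c : measurableTypeR R) (isMeasurableFun.Build _ _ _ _ _ mshift).
apply/esym.
rewrite (@lebesgue_measure_unique _ (pushforward mu f))//= => _ [[a b]] _ <-.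
rewrite /pushforward/=.
rewrite (_ : _ @^-1` _ = `]a - c, b - c]%classic); last first.
  by apply/seteqP; split => x /=; rewrite !in_itv/= ltrBlDr lerBrDr.
rewrite !lebesgue_measure_itv/= !lte_fin ltrD2r.
by case: ifP => // _; rewrite -!EFinD; congr EFin; ring.
Qed.

(** An Egorov-type set: intersecting over all [m >= n] makes it increase with [n], so that
    continuity of the measure from below applies. *)
Definition almost_const (k : R -> R) (z : nat -> R) (e : R) (n : nat) : set R :=
  `[0, 2]%classic `&` \bigcap_(m in [set m | (n <= m)%N])
    [set s | `|k (z m + s) - k (z m)| <= e].

Lemma measurable_almost_const k z e n : measurable_fun setT k ->
  measurable (almost_const k z e n).
Proof.
move=> mk; apply: measurableI => //; apply: bigcap_measurable; first by exists n => /=.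
move=> m _.
have -> : [set s | `|k (z m + s) - k (z m)| <= e] =
    (fun s => `|k (z m + s) - k (z m)|) @^-1` `]-oo, e]%classic.
  by apply/seteqP; split => s /=; rewrite in_itv.
rewrite -[X in measurable X]setTI.
have mf : measurable_fun setT (fun s => `|k (z m + s) - k (z m)|).
  apply: measurableT_comp => //; apply: measurable_funB => //.
  by apply: measurableT_comp => //; exact: measurable_funD.
exact: mf.
Qed.

Lemma almost_const_nondecreasing k z e m n : (m <= n)%N ->
  almost_const k z e m `<=` almost_const k z e n.
Proof. by move=> mn s [s02 H]; split => // i /= ni; apply: H; exact: leq_trans ni. Qed.

(** Pointwise convergence puts each [s] of [[0, 2]] in all late sets, so their measures increase to
    2. The level 3/2 is half the length of [[0, 3]]: two such sets, one of them translated by at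
    most 1, cannot be disjoint. *)
Lemma almost_const_large k z e : measurable_fun setT k ->
  (forall t, k (x + t) - k x @[x --> +oo] --> 0) ->
  z n @[n --> \oo] --> +oo -> 0 < e ->
  exists n0, forall n, (n0 <= n)%N -> ((3 / 2)%:E < mu (almost_const k z e n))%E.
Proof.
move=> mk hk zoo e0.
have mU := measurable_almost_const k z e ^~ mk.
have U : \bigcup_n almost_const k z e n = `[0, 2]%classic.
  apply/seteqP; split => [s [n _ []]//|s s02].
  have /cvgrPdist_le/(_ e e0) H := hk s.
  have := zoo _ H; rewrite /= nbhs_filterE => -[n _ nH].
  by exists n => //; split => // m /= nm; have := nH m nm; rewrite /= sub0r normrN.
have [n0 Hn0] : exists n0, ((3 / 2)%:E < mu (almost_const k z e n0))%E.
  apply: contrapT => /forallNP Hall.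
  suff : (mu `[0%R, 2%R]%classic <= (3 / 2)%:E)%E.
    by rewrite lebesgue_measure_itv/= lte_fin ltr0n/= oppr0 adde0 lee_fin; lra.
  rewrite -U; have cv : (mu \o almost_const k z e) @ \oo --> mu (\bigcup_n almost_const k z e n).
    apply: nondecreasing_cvg_mu => //; first by rewrite U.
    by move=> m n mn; apply/subsetPset; exact: almost_const_nondecreasing.
  apply: (cvge_le _ cv); by near=> n => /=; rewrite leNgt; apply/negP/Hall.
exists n0 => n nn; apply: (lt_le_trans Hn0).
apply: le_measure; rewrite ?inE; [exact: mU|exact: mU|exact: almost_const_nondecreasing].
Unshelve. all: end_near. Qed.

(** The uniform convergence theorem in additive variables, by contradiction: along a failing
    sequence, the pointwise hypothesis is used both from the base points [x n] and from the shifted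
    points [z n], and a common point links the two by the triangle inequality. *)
Lemma uniform_shift k : measurable_fun setT k ->
  (forall t, k (x + t) - k x @[x --> +oo] --> 0) ->
  forall e, 0 < e -> exists x0, forall x t, x0 <= x -> 0 <= t <= 1 ->
    `|k (x + t) - k x| <= e.
Proof.
move=> mk hk e e0; apply: contrapT => /forallNP Hn.
have /choice[w Hw] : forall n : nat, exists w : R * R,
    [/\ n%:R <= w.1, 0 <= w.2 <= 1 & e < `|k (w.1 + w.2) - k w.1| ].
  move=> n; have := Hn n%:R => /existsNP[x] /existsNP[t].
  move=> /not_implyP[nx] /not_implyP[t01] /negP; rewrite -ltNge => H.
  by exists (x, t).
pose x n := (w n).1; pose z n := (w n).1 + (w n).2.
have xoo : x n @[n --> \oo] --> +oo.
  apply/cvgryPge => A; near=> n; apply: (@le_trans _ _ n%:R).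
    by near: n; exact: nbhs_infty_ger.
  by have [] := Hw n.
have zoo : z n @[n --> \oo] --> +oo.
  apply: ger_cvgy xoo; near=> n; rewrite /x /z lerDl.
  by have [_ /andP[]] := Hw n.
have e20 : 0 < e / 2 by rewrite divr_gt0.
have [n1 Hn1] := almost_const_large _ _ _ mk hk xoo e20.
have [n2 Hn2] := almost_const_large _ _ _ mk hk zoo e20.
pose n := maxn n1 n2; pose t := (w n).2.
have [_ /andP[t0 t1] Hk] := Hw n.
(* [V] and [W] lie in [0, 3] and have measure > 3/2 each, so they meet; at a common
   point the increments of [k] from [x n] and from [z n] are both small. *)
pose V := almost_const k x (e / 2) n.
pose W := (fun s => s + - t) @^-1` almost_const k z (e / 2) n.
have mV : measurable V by exact: measurable_almost_const.
have mW : measurable W.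
  rewrite -[W]setTI; have : measurable_fun [set: R] (fun x : R => x + - t).
    by apply: measurable_funD.
  by apply => //; exact: measurable_almost_const.
have [VW0|/eqP/set0P[s [[s02 sV] [_ sW]]]] := pselect (V `&` W = set0).
  have : (mu (V `|` W) <= mu `[0%R, 3%R]%classic)%E.
    apply: le_measure; rewrite ?inE//; first exact: measurableU.
    move=> s [[+ _]|[+ _]]; rewrite /= !in_itv/= => /andP[a b]; rewrite /t; apply/andP; split; lra.
  rewrite measureU// lebesgue_measure_itv/= lte_fin ltr0n/= oppr0 adde0.
  rewrite [X in (_ + X)%E]lebesgue_measure_shift; last exact: measurable_almost_const.
  have := lteD (Hn1 _ (leq_maxl n1 n2)) (Hn2 _ (leq_maxr n1 n2)).
  move=> /lt_le_trans /[apply].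
  by rewrite -EFinD lte_fin; lra.
have := sV n (leqnn n); have := sW n (leqnn n); rewrite /= /x /z.
rewrite (_ : (w n).1 + _ + _ = (w n).1 + s); last by rewrite /t; ring.
move: Hk; rewrite !ler_norml ltr_normr => /orP[?|?] /andP[? ?] /andP[? ?]; lra.
Unshelve. all: end_near. Qed.

(** A shift is cut into unit shifts and a remainder below 1, each costing [e]. Linear growth in the
    additive variable is logarithmic growth in the multiplicative one. *)
Lemma linear_shift k : measurable_fun setT k ->
  (forall t, k (x + t) - k x @[x --> +oo] --> 0) ->
  forall e, 0 < e -> exists x0, forall x t, x0 <= x -> 0 <= t ->
    `|k (x + t) - k x| <= e * (1 + t).
Proof.
move=> mk hk e e0; have [x0 H] := uniform_shift _ mk hk _ e0.
exists x0 => x t x0x t0.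
have Hn : forall n : nat, `|k (x + n%:R) - k x| <= e * n%:R.
  elim=> [|n IH]; first by rewrite addr0 subrr normr0 mulr0.
  have := H (x + n%:R) 1; rewrite lexx ler01 => /(_ _ isT) h1.
  have {}h1 := h1 (le_trans x0x (ler_wpDr (ler0n _ _) (lexx _))).
  rewrite -natr1 addrA mulrDr mulr1.
  by rewrite -(subrKA (k (x + n%:R))) [leRHS]addrC (le_trans (ler_normD _ _))// lerD.
have /andP[n1 n2] := truncn_itv t0; set n := Num.truncn t in n1 n2.
have := H (x + n%:R) (t - n%:R); rewrite (_ : x + n%:R + (t - n%:R) = x + t); last by ring.
have x0n : x0 <= x + n%:R by rewrite (le_trans x0x)// lerDl.
have tn : 0 <= t - n%:R <= 1 by rewrite subr_ge0 n1/= lerBlDr nat1r ltW.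
move=> /(_ x0n tn) h; rewrite -(subrKA (k (x + n%:R))) (le_trans (ler_normD _ _))//.
by rewrite mulrDr mulr1 lerD// (le_trans (Hn n))// ler_wpM2l// ltW.
Qed.
End uniform_convergence.

(** Potter's bounds, for the logarithm of a regularly varying function. The slope [b] comes before
    [e]: the additive error can be made small without steepening the slope, which makes [l] nearly
    constant on relatively short ranges. *)
Definition potter {R : realType} (l : R -> R) := exists2 b : R, 0 <= b &
  forall e, 0 < e -> exists2 x0, 0 < x0 & forall x y, x0 <= x -> x <= y ->
    `|l y - l x| <= e + b * ln (y / x).

(** * Potter's bounds from the uniform convergence theorem *)

Section potter.
Context {R : realType}.
Implicit Types (g l : R -> R).

Lemma cvgry_expR : @expR R x @[x --> +oo] --> +oo.
Proof.
apply/cvgryPge => A; near=> x; apply: le_trans (expR_ge1Dx x).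
by rewrite -lerBlDl; near: x; apply: nbhs_pinfty_ge; rewrite num_real.
Unshelve. all: end_near. Qed.

(** In the variable [ln x], removing the index [a] leaves [k], whose increments tend to 0;
    [linear_shift] bounds them and [a * ln (y / x)] is put back. *)
Lemma regularly_varying_potter g : regularly_varying g -> potter (fun x => ln (g x)).
Proof.
move=> [mg [[x1 g0] [a ga]]].
exists (`|a| + 1); first by rewrite addr_ge0.
move=> e e0.
pose k x := ln (g (expR x)) - a * x.
have mk : measurable_fun setT k.
  apply: measurable_funB.
    by apply: measurableT_comp => //; apply: measurableT_comp => //.
  exact: measurable_funM.
have gpos c : 0 < c -> \forall x \near +oo, 0 < g (c * expR x).
  move=> c0; have := cvgry_expR => /cvgryPgt/(_ (x1 / c)); apply: filterS => y.
  by rewrite ltr_pdivrMr// mulrC; exact: g0.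
have hk t : k (x + t) - k x @[x --> +oo] --> 0.
  have H1 : g (expR t * expR x) / g (expR x) @[x --> +oo] --> expR t `^ a.
    exact: (cvg_comp (@expR R) (fun y => g (expR t * y) / g y) cvgry_expR (ga _ (expR_gt0 t))).
  have H2 : ln (g (expR t * expR x) / g (expR x)) @[x --> +oo] --> a * t.
    rewrite -[X in a * X]expRK -ln_powR.
    apply: (cvg_comp _ (@ln R) H1); apply: continuous_ln; exact: powR_gt0 (expR_gt0 t).
  rewrite -(subrr (a * t)).
  have H3 : ln (g (expR t * expR x) / g (expR x)) - a * t @[x --> +oo] --> a * t - a * t.
    by apply: cvgB => //; exact: cvg_cst.
  apply: cvg_trans H3; apply: near_eq_cvg; near=> x.
  rewrite /k ln_div ?posrE.
  - rewrite expRD [expR t * _]mulrC; ring.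
  - by near: x; apply: gpos; exact: expR_gt0.
  - rewrite -[expR x]mul1r; near: x; exact: gpos.
(* The cap at 1 keeps the slope below [|a| + 1] whatever [e] is. *)
have e1 : 0 < Num.min e 1 by rewrite lt_min e0 ltr01.
have [x0 Hx0] := linear_shift _ mk hk _ e1.
exists (expR x0); first exact: expR_gt0.
move=> x y x0x xy; have x_gt0 : 0 < x by rewrite (lt_le_trans _ x0x)// expR_gt0.
have y_gt0 : 0 < y by rewrite (lt_le_trans _ xy).
have := Hx0 (ln x) (ln (y / x)).
rewrite -ler_expR lnK ?posrE// => /(_ x0x).
have lnge0 : 0 <= ln (y / x) by apply: ln_ge0; rewrite ler_pdivlMr// mul1r.
move=> /(_ lnge0); rewrite /k expRD !lnK ?posrE ?divr_gt0//.
rewrite (mulrC x) divfK ?gt_eqF// => h.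
rewrite (_ : _ - _ = ln (g y) - a * (ln x + ln (y / x)) - (ln (g x) - a * ln x) + a * ln (y /
  x)); last first.
  by rewrite /=; ring.
apply: (le_trans (ler_normD _ _)); apply: (le_trans (lerD h (lexx _))).
rewrite normrM (ger0_norm lnge0) mulrDr mulr1 -addrA lerD ?ge_min ?lexx// addrC mulrDl lerD2l.
by rewrite ler_wpM2r// ge_min lexx orbT.
Unshelve. all: end_near. Qed.

End potter.

Section potter_consequences.
Context {R : realType}.
Implicit Types (l : R -> R) (a c e s t x y : R).

Lemma ln_le_sub1 x : 0 < x -> ln x <= x - 1.
Proof. by move=> x0; rewrite -[in ln _](subrKC 1 x) le_ln1Dx// ltrBrDl subrr. Qed.

Lemma potter_ratio l : potter l -> exists2 b, 0 <= b &
  forall e, 0 < e -> exists2 x0, 0 < x0 & forall x y, x0 <= x -> x0 <= y ->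
    `|l y - l x| <= e + b * (`|y - x| / Num.min x y).
Proof.
move=> [b b0 H]; exists b => // e e0; have [x0 x00 Hx0] := H e e0; exists x0 => // x y.
wlog xy : x y / x <= y.
  move=> W xx yy; have /orP[xy|yx] := le_total x y; first exact: W.
  by have := W y x yx yy xx; rewrite distrC (distrC x) [Num.min y x]minC.
move=> xx _; apply: (le_trans (Hx0 _ _ xx xy)); rewrite lerD2l ler_wpM2l//.
have x_gt0 := lt_le_trans x00 xx; have y_gt0 := lt_le_trans x_gt0 xy.
rewrite min_l// ger0_norm ?subr_ge0// mulrBl divff ?gt_eqF//.
by apply: ln_le_sub1; rewrite divr_gt0.
Qed.

(** A logarithm is below any linear function. For [l = elog T] this gives [T x] the order
    [exp (- x)] up to [exp (e * x)], enough to discard remote ranges. *)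
Lemma potter_sublinear l e : potter l -> 0 < e ->
  \forall x \near +oo, `|l x| <= e * x.
Proof.
move=> [b b0 H] e0; have [x0 x00 Hx0] := H 1 ltr01.
have b1 : 0 < b + 1 by rewrite ltr_wpDl.
pose c := e / 2 / (b + 1); have c0 : 0 < c by rewrite !divr_gt0.
have lnc x : 0 < x -> ln (x / x0) <= c * x - ln (c * x0).
  move=> x_gt0; have cx : 0 < c * x by exact: mulr_gt0.
  have cx0 : 0 < c * x0 by exact: mulr_gt0.
  have -> : x / x0 = (c * x) / (c * x0) by field; rewrite !gt_eqF.
  by rewrite ln_div ?posrE// lerD2r ltW// ln_sublinear.
near=> x.
have xx0 : x0 <= x by near: x; apply: nbhs_pinfty_ge; rewrite num_real.
have x_gt0 := lt_le_trans x00 xx0.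
have h := Hx0 _ _ (lexx x0) xx0.
have h1 := lnc x x_gt0.
have h2 : b * ln (x / x0) <= e / 2 * x - b * ln (c * x0).
  apply: (le_trans (ler_wpM2l b0 h1)); rewrite mulrBr lerD2r mulrA; apply: ler_wpM2r; first
    exact: ltW.
  by rewrite /c mulrCA -[leRHS]mulr1 ler_wpM2l ?divr_ge0 ?ltW// ltr_pdivrMr// mul1r ltrDl.
have h3 : 1 - b * ln (c * x0) + `|l x0| <= e / 2 * x.
  rewrite -ler_pdivrMl ?divr_gt0//; near: x; apply: nbhs_pinfty_ge; rewrite num_real.
have : `|l x| <= `|l x - l x0| + `|l x0| by rewrite -[in leLHS](subrK (l x0) (l x)) ler_normD.
lra.
Unshelve. all: end_near. Qed.

(** The window around [s * c] has relative width [d], independent of [s], so any window of width of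
    order [sqrt s] eventually fits inside. *)
Lemma potter_local l c e : potter l -> 0 < c -> 0 < e ->
  exists2 d, 0 < d & \forall s \near +oo, forall t, `|t - c| <= d ->
    `|l (s * t) - l (s * c)| <= e.
Proof.
move=> /potter_ratio[b b0 H] c0 e0; have e20 : 0 < e / 2 by rewrite divr_gt0.
have [x0 x00 Hx0] := H _ e20.
have b1 : 0 < b + 1 by rewrite ltr_wpDl.
exists (Num.min (c / 2) (c / 2 * (e / 2 / (b + 1)))).
  by rewrite lt_min !(divr_gt0, mulr_gt0).
near=> s => t; rewrite le_min => /andP[t1 t2].
have s0 : 0 < s by near: s; apply: nbhs_pinfty_gt; rewrite num_real.
have tc : c / 2 <= t by move: t1; rewrite ler_norml => /andP[]; lra.
have ss : x0 <= s * (c / 2).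
  by rewrite -ler_pdivrMr ?divr_gt0//; near: s; apply: nbhs_pinfty_ge; rewrite num_real.
have h1 : s * (c / 2) <= s * c by rewrite ler_pM2l//; lra.
have h2 : s * (c / 2) <= s * t by rewrite ler_pM2l.
have sc0 : 0 < s * (c / 2) by rewrite mulr_gt0// divr_gt0.
apply: (le_trans (Hx0 _ _ (le_trans ss h1) (le_trans ss h2))).
have m0 : s * (c / 2) <= Num.min (s * c) (s * t) by rewrite le_min h1.
suff : b * (`|s * t - s * c| / Num.min (s * c) (s * t)) <= e / 2 by lra.
have : `|s * t - s * c| / Num.min (s * c) (s * t) <= e / 2 / (b + 1).
  rewrite ler_pdivrMr; last by rewrite (lt_le_trans _ m0).
  rewrite -mulrBr normrM (gtr0_norm s0).
  apply: (@le_trans _ _ (e / 2 / (b + 1) * (s * (c / 2)))); last first.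
    by rewrite ler_wpM2l// !divr_ge0// ltW.
  by rewrite mulrCA ler_pM2l// mulrC.
move=> /(ler_wpM2l b0)/le_trans; apply.
by rewrite mulrCA -[leRHS]mulr1 ler_wpM2l ?divr_ge0 ?ltW// ltr_pdivrMr// mul1r ltrDl.
Unshelve. all: end_near. Qed.

(** For arguments comparable with [s] the quotients in [potter_ratio] are bounded; unlike in
    [potter_local], the resulting bound is not small. *)
Lemma potter_bounded l a a' c : potter l -> 0 < a -> 0 < c ->
  exists C, \forall s \near +oo, forall t, a <= t <= a' ->
    `|l (s * t) - l (s * c)| <= C.
Proof.
move=> /potter_ratio[b b0 H] a0 c0; have [x0 x00 Hx0] := H _ ltr01.
have m0 : 0 < Num.min a c by rewrite lt_min a0.
exists (1 + b * ((`|a'| + c) / Num.min a c)); near=> s => t /andP[at1 ta].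
have s0 : 0 < s by near: s; apply: nbhs_pinfty_gt; rewrite num_real.
have ss : x0 <= s * Num.min a c.
  by rewrite -ler_pdivrMr//; near: s; apply: nbhs_pinfty_ge; rewrite num_real.
have h1 : s * Num.min a c <= s * c by rewrite ler_pM2l// ge_min lexx orbT.
have h2 : s * Num.min a c <= s * t by rewrite ler_pM2l// ge_min at1.
have t0 := lt_le_trans a0 at1.
apply: (le_trans (Hx0 _ _ (le_trans ss h1) (le_trans ss h2))).
rewrite lerD2l ler_wpM2l// -mulrBr normrM (gtr0_norm s0).
have sm0 : 0 < s * Num.min a c by rewrite mulr_gt0.
rewrite ler_pdivrMr; last by rewrite lt_min !mulr_gt0.
apply: (@le_trans _ _ ((`|a'| + c) / Num.min a c * (s * Num.min a c))).
  rewrite mulrCA ler_pM2l// divfK ?gt_eqF//.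
  rewrite (le_trans (ler_normB _ _))// (gtr0_norm c0) lerD2r.
  by rewrite (gtr0_norm t0) (le_trans ta)// ler_norm.
apply: ler_wpM2l; last by rewrite le_min h1.
by apply: divr_ge0; [apply: addr_ge0 => //|]; exact: ltW.
Unshelve. all: end_near. Qed.

(** On the range [x >= s * a] a displacement of at most 1 is a relative displacement of order
    [1 / s]. *)
Lemma potter_step l a e : potter l -> 0 < a -> 0 < e ->
  \forall s \near +oo, forall x y, s * a <= x -> s * a <= y -> `|y - x| <= 1 ->
    `|l y - l x| <= e.
Proof.
move=> /potter_ratio[b b0 H] a0 e0; have e20 : 0 < e / 2 by rewrite divr_gt0.
have [x0 x00 Hx0] := H _ e20; have b1 : 0 < b + 1 by rewrite ltr_wpDl.
near=> s => x y sx sy xy.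
have s0 : 0 < s by near: s; apply: nbhs_pinfty_gt; rewrite num_real.
have ss : x0 <= s * a.
  by rewrite -ler_pdivrMr//; near: s; apply: nbhs_pinfty_ge; rewrite num_real.
apply: (le_trans (Hx0 _ _ (le_trans ss sx) (le_trans ss sy))).
have sa0 : 0 < s * a by rewrite mulr_gt0.
have m0 : s * a <= Num.min x y by rewrite le_min sx.
suff : b * (`|y - x| / Num.min x y) <= e / 2 by lra.
have : `|y - x| / Num.min x y <= e / 2 / (b + 1).
  rewrite ler_pdivrMr; last by rewrite (lt_le_trans _ m0).
  apply: (le_trans xy); apply: (@le_trans _ _ (e / 2 / (b + 1) * (s * a))); last first.
    by rewrite ler_wpM2l// !divr_ge0// ltW.
  rewrite mulrA -ler_pdivrMr//; have K0 : 0 < e / 2 / (b + 1) by rewrite divr_gt0.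
  by rewrite div1r -ler_pdivrMl//; near: s; apply: nbhs_pinfty_ge; rewrite num_real.
move=> /(ler_wpM2l b0)/le_trans; apply.
by rewrite mulrCA -[leRHS]mulr1 ler_wpM2l ?divr_ge0 ?ltW// ltr_pdivrMr// mul1r ltrDl.
Unshelve. all: end_near. Qed.

End potter_consequences.

(** * The level curve of the product and its convex rate *)

Section rate.
Context {R : realType}.
Variables lam mu : R.
Hypotheses (lam0 : 0 < lam) (mu0 : 0 < mu) (lammu : lam + mu = 1).
Implicit Types (t x : R).

(* The level curve (x1 / lam)^lam (x2 / mu)^mu = 1, seen as x1 = level x2: for
   s = B u^q, the event Y1 Y2 > u is X1 > s * level (X2 / s). *)
Definition level t := lam * (t / mu) `^ (- (mu / lam)).
(* The exponent x1 + x2 along the level curve, minus its minimal value 1. *)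
Definition rate t := t + level t - 1.

Lemma level_gt0 t : 0 < t -> 0 < level t.
Proof. by move=> t0; rewrite mulr_gt0// powR_gt0// divr_gt0. Qed.

Lemma level_mu : level mu = lam.
Proof. by rewrite /level divff ?gt_eqF// powR1 mulr1. Qed.

Lemma level_exp t : 0 < t -> level t = lam * expR (- (mu / lam) * ln (t / mu)).
Proof. by move=> t0; rewrite /level /powR gt_eqF// divr_gt0. Qed.

Lemma level_le x t : 0 < x -> x <= t -> level t <= level x.
Proof.
move=> x0 xt; have t0 : 0 < t by rewrite (lt_le_trans x0).
rewrite !level_exp// ler_pM2l// ler_expR !mulNr lerN2 ler_pM2l ?divr_gt0//.
by rewrite ler_ln ?posrE ?divr_gt0// ler_pM2r ?invr_gt0.
Qed.

Lemma rate_mu : rate mu = 0.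
Proof. by rewrite /rate level_mu addrC [mu + _]addrC lammu addNr. Qed.

(** With [t = mu * exp z] one has [level t = lam * exp (- (mu / lam) * z)]; bounding both
    exponentials below by their tangents at 0, the terms linear in [z] cancel. *)
Lemma rate_ge0 t : 0 < t -> 0 <= rate t.
Proof.
move=> t0; rewrite /rate level_exp//; set z := ln (t / mu).
have -> : t = mu * expR z.
  by rewrite /z lnK ?posrE ?divr_gt0// mulrC divfK// gt_eqF.
have h1 := expR_ge1Dx z; have h2 := expR_ge1Dx (- (mu / lam) * z).
have := ler_wpM2l (ltW mu0) h1; have := ler_wpM2l (ltW lam0) h2.
have -> : lam * (1 + - (mu / lam) * z) = lam - mu * z by field; rewrite gt_eqF.
by rewrite mulrDr mulr1; move: lammu; lra.
Qed.

(** Convexity of the exponential between 0 and [z]: its tangent at [w = a * z] lies below it at both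
    ends. *)
Lemma expR_weighted_le (a z : R) : 0 <= a <= 1 -> expR (a * z) <= 1 - a + a * expR z.
Proof.
move=> /andP[a0 a1]; set w := a * z.
have h1 := expR_ge1Dx (z - w); have h2 := expR_ge1Dx (- w).
have e0 := expR_gt0 w.
have h3 : a * expR (z - w) + (1 - a) * expR (- w) >= 1.
  have := ler_wpM2l a0 h1; have := ler_wpM2l (_ : 0 <= 1 - a) h2.
  rewrite subr_ge0 => /(_ a1); rewrite /w; lra.
have := ler_wpM2l (ltW e0) h3.
rewrite mulr1 mulrDr !mulrA ![expR w * _]mulrC -!mulrA -!expRD subrr expR0.
by rewrite subrKC mulr1; lra.
Qed.

(** The part of convexity that is used: as [rate mu = 0], a lower bound at one distance from [mu]
    propagates linearly outwards. In the proof, concavity of [ln] gives [wz], the negative exponent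
    [c] reverses it, and convexity of [expR] concludes. *)
Lemma rate_star_shaped (a x : R) : 0 <= a <= 1 -> 0 < mu + x ->
  rate (mu + a * x) <= a * rate (mu + x).
Proof.
move=> a01 x0; have /andP[a0 a1] := a01.
have ax0 : 0 < mu + a * x.
  have -> : mu + a * x = (1 - a) * mu + a * (mu + x) by ring.
  have [->|a_neq0] := eqVneq a 0; first by rewrite subr0 mul1r mul0r addr0.
  apply: ltr_wpDl; first by rewrite mulr_ge0 ?subr_ge0// ltW.
  by rewrite mulr_gt0// lt_def a_neq0.
suff : level (mu + a * x) <= (1 - a) * lam + a * level (mu + x).
  by rewrite /rate; move: lammu; nra.
rewrite !level_exp//; set c := - (mu / lam).
set z := ln ((mu + x) / mu); set w := ln _.
have wz : a * z <= w.
  rewrite -ler_expR /w lnK ?posrE ?divr_gt0//.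
  apply: (le_trans (expR_weighted_le _ _ a01)); rewrite /z lnK ?posrE ?divr_gt0//.
  rewrite le_eqVlt; apply/orP; left; apply/eqP; field; by rewrite gt_eqF.
have c0 : c < 0 by rewrite oppr_lt0 divr_gt0.
have : expR (c * w) <= expR (a * (c * z)).
  by rewrite ler_expR mulrCA ler_nM2l.
move=> /le_trans/(_ (expR_weighted_le _ _ a01)) /(ler_wpM2l (ltW lam0)).
by rewrite mulrDr; lra.
Qed.

Lemma is_derive_div_powR (c t : R) : 0 < t ->
  is_derive t 1 (fun x => (x / mu) `^ c) (c / mu * (t / mu) `^ (c - 1)).
Proof.
move=> t0; have tm : 0 < t / mu by rewrite divr_gt0.
have h1 : is_derive t 1 (fun x => x / mu) mu^-1.
  rewrite (_ : (fun x => _) = mu^-1 \*: id); last first.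
    by apply/funext => x; rewrite /= mulrC.
  by apply: is_derive_eq; rewrite -[RHS]mulr1.
have h2 : is_derive (t / mu) 1 (@powR R ^~ c) (c * (t / mu) `^ (c - 1)).
  have tin : t / mu \in `]0, +oo[ by rewrite in_itv/= andbT.
  apply: DeriveDef; first exact: derivable_powR.
  by rewrite -derive1E powR_derive1.
rewrite (_ : (fun x => _) = (@powR R ^~ c) \o (fun x => x / mu))//.
have h3 := @is_derive1_comp _ (@powR R ^~ c) (fun x => x / mu) _ _ _ h2 h1.
apply: (is_derive_eq h3).
by rewrite mulrAC.
Qed.

(** The derivative of [rate]; the exponent [- (mu / lam) - 1] equals [- lam^-1] because
    [lam + mu = 1]. *)
Definition drate t := 1 - (t / mu) `^ (- lam^-1).

Lemma is_derive_rate t : 0 < t -> is_derive t 1 rate (drate t).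
Proof.
move=> t0; have h := is_derive_div_powR (- (mu / lam)) _ t0.
rewrite (_ : rate = id + (lam \*: (fun x => (x / mu) `^ (- (mu / lam)))) + cst (-1)); last first.
  by apply/funext => x.
apply: is_derive_eq; rewrite subr0 /drate; congr +%R.
rewrite (_ : - (mu / lam) - 1 = - lam^-1).
  rewrite /= /GRing.scale /=; field; by rewrite !gt_eqF.
apply: (@mulIf _ lam); rewrite ?gt_eqF// mulNr mulVf ?gt_eqF// mulrBl mulNr divfK ?gt_eqF//.
by rewrite mul1r; move: lammu; lra.
Qed.

Lemma is_derive_drate : is_derive mu 1 drate (lam * mu)^-1.
Proof.
have h := is_derive_div_powR (- lam^-1) _ mu0.
rewrite (_ : drate = cst 1 - (fun x => (x / mu) `^ (- lam^-1))); last first.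
  by apply/funext => x.
apply: is_derive_eq; rewrite sub0r divff ?gt_eqF// powR1.
rewrite /= /GRing.scale /=; field; by rewrite !gt_eqF.
Qed.

(** Differentiability of [drate] at [mu] bounds the derivative of the remainder [F] by [e * |x|],
    and the mean value theorem brings the second factor [|x|]. The bound [d <= mu / 2] keeps
    [mu + x] positive. *)
Lemma rate_quadratic (e : R) : 0 < e -> exists2 d, 0 < d <= mu / 2 &
  forall x, `|x| <= d -> `|rate (mu + x) - x ^+ 2 / (2 * lam * mu)| <= e * x ^+ 2.
Proof.
move=> e0; have drate_mu : drate mu = 0.
  by rewrite /drate divff ?gt_eqF// powR1 subrr.
have [d d0 Hd] : exists2 d, 0 < d & forall x, `|x| < d ->
    `|drate (mu + x) - x / (lam * mu)| <= e * `|x|.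
  have [hd hv] := is_derive_drate.
  have := hd; rewrite /derivable => /cvg_ex[l Hl].
  have El : l = (lam * mu)^-1 by rewrite -hv /derive; apply/esym/cvg_lim.
  move: Hl; rewrite El => /cvgrPdist_le/(_ e e0).
  rewrite near_withinE => /nbhs_ballP[d /= d0 H]; exists d => // x xd.
  have [->|x_neq0] := eqVneq x 0.
    by rewrite addr0 drate_mu mul0r subr0 normr0 mulr0.
  have := H x; rewrite /ball/= sub0r normrN => /(_ xd x_neq0).
  rewrite drate_mu subr0 /GRing.scale /= mulr1 distrC [x + mu]addrC => h.
  rewrite -(ler_pM2r (_ : 0 < `|x|)) ?normr_gt0// in h.
  rewrite -normrM mulrBl mulrAC mulVf// mul1r [_^-1 * x]mulrC in h; exact: h.
exists (Num.min (d / 2) (mu / 2)).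
  by rewrite lt_min !divr_gt0//= ge_min lexx orbT.
move=> x; rewrite le_min => /andP[xd xm].
pose F t := rate t - (t - mu) ^+ 2 / (2 * lam * mu).
pose dF t := drate t - (t - mu) / (lam * mu).
have dFP t : 0 < t -> is_derive t 1 F (dF t).
  move=> t0; have h := is_derive_rate _ t0.
  rewrite (_ : F = rate - ((2 * lam * mu)^-1 \*: (fun t => (t - mu) ^+ 2))); last first.
    by apply/funext => y; rewrite /F [X in _ - X]mulrC.
  have h2 : is_derive t 1 (fun t => (t - mu) ^+ 2) (2 * (t - mu)).
    rewrite (_ : (fun t => _) = (id + cst (- mu)) ^+ 2); last first.
      by apply/funext => y; rewrite fctE.
    by apply: is_derive_eq; rewrite fctE /= /GRing.scale /= subr0 mulr1 expr1.
  apply: is_derive_eq; rewrite /dF /= /GRing.scale /=; congr +%R.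
  by field; rewrite !gt_eqF.
have Fmu : F mu = 0 by rewrite /F rate_mu subrr expr0n/= mul0r subr0.
have key a b : a <= b -> 0 < a -> exists2 c, c \in `[a, b] & F b - F a = dF c * (b - a).
  move=> ab a0; apply: MVT_segment => //.
    by move=> y; rewrite in_itv/= => /andP[ay _]; apply: dFP; rewrite (lt_trans a0).
  apply: derivable_within_continuous => y; rewrite in_itv/= => /andP[ay _].
  by have [] := dFP y (lt_le_trans a0 ay).
have dFb c : `|c - mu| <= `|x| -> `|dF c| <= e * `|x|.
  move=> cx; have := Hd (c - mu); rewrite addrCA subrr addr0 => h.
  apply: (le_trans (h _)); last by rewrite ler_pM2l.
  by rewrite (le_lt_trans cx)// (le_lt_trans xd)// ltr_pdivrMr// ltr_pMr// ltr1n.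
rewrite (_ : rate _ - _ = F (mu + x) - F mu); last by rewrite Fmu subr0 /F (_ : mu + x - mu =
  x)//; ring.
rewrite -(real_normK (num_real x)) expr2 mulrA.
have [x0|x0] := leP 0 x.
  have [||c] := key mu (mu + x); rewrite ?lerDl// in_itv/= => /andP[c1 c2] ->.
  rewrite (_ : mu + x - mu = x); last by ring.
  rewrite normrM ler_wpM2r// dFb// !ger0_norm ?subr_ge0// lerBlDl//.
have mx : 0 < mu + x.
  by move: xm; rewrite ltr0_norm//; move: mu0; lra.
have mxmu : mu + x <= mu by rewrite gerDl ltW.
have [c] := key _ _ mxmu mx; rewrite in_itv/= => /andP[c1 c2].
rewrite -(normrN (F _ - _)) [- (F _ - _)]opprB => ->; rewrite (_ : mu - (mu + x) = - x); last
  by ring.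
rewrite normrM normrN ler_wpM2r// dFb//.
by rewrite (ltr0_norm x0) ler0_norm ?subr_le0// opprB lerBlDl -lerBlDr opprK.
Qed.

End rate.

(** * Gaussian and geometric sums *)

Section gauss_sums.
Context {R : realType}.
Local Notation gint := (@gauss_integral_proof.integral0_gauss R).
Local Notation gf := (@gauss_fun R).

Lemma gauss_fun_le (x y : R) : 0 <= x -> x <= y -> gf y <= gf x.
Proof. by move=> x0 xy; rewrite ler_expR lerN2 ler_pXn2r// nnegrE// (le_trans x0). Qed.

Lemma gint0 : gint 0 = 0.
Proof. by rewrite /gauss_integral_proof.integral0_gauss set_itv1 Rintegral_set1. Qed.

Lemma integrable_gauss (a b : R) : (@lebesgue_measure R).-integrable `[a, b]%classic (EFin \o gf).
Proof. by apply: integrableS (@integrableT_gauss R). Qed.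

Lemma gint_bounds (a b : R) : 0 <= a -> a <= b ->
  (b - a) * gf b <= gint b - gint a <= (b - a) * gf a.
Proof.
move=> a0 ab; rewrite /gauss_integral_proof.integral0_gauss.
rewrite Rintegral_itvB ?bnd_simp//; last exact: integrable_gauss.
have io : (@lebesgue_measure R).-integrable `]a, b]%classic (EFin \o gf).
  by apply: integrableS (@integrableT_gauss R).
have ic (c : R) : (@lebesgue_measure R).-integrable `]a, b]%classic (EFin \o (fun=> c)).
  have H : (@lebesgue_measure R).-integrable `[a, b]%classic (EFin \o (fun=> c)).
    apply: continuous_compact_integrable; first exact: segment_compact.
    by apply: continuous_subspaceT => x; exact: cvg_cst.
  by apply: (integrableS _ _ _ H) => //; exact: subset_itv_oc_cc.
have mE (c : R) : \int[@lebesgue_measure R]_(x in `]a, b]) c = (b - a) * c.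
  rewrite Rintegral_cst//= lebesgue_measure_itv/= lte_fin.
  by move: ab; rewrite le_eqVlt => /predU1P[->|->]; rewrite ?ltxx ?subrr ?mul0r ?mulr0// mulrC.
rewrite -!mE; apply/andP; split; apply: le_Rintegral => //= x; rewrite in_itv/= => /andP[ax xb].
  by apply: gauss_fun_le => //; rewrite (le_trans a0)// ltW.
by apply: gauss_fun_le => //; exact: ltW.
Qed.

Lemma gint_le (a b : R) : 0 <= a -> a <= b -> gint a <= gint b.
Proof.
move=> a0 ab; have /andP[h _] := gint_bounds _ _ a0 ab.
by rewrite -subr_ge0; apply: le_trans h; rewrite mulr_ge0 ?subr_ge0// gauss_fun_ge0.
Qed.

Lemma cvg_gint : gint x @[x --> +oo] --> Num.sqrt pi / 2.
Proof.
have : Num.sqrt (gint x ^+ 2) @[x --> +oo] --> Num.sqrt (pi / 4 : R).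
  apply: continuous_cvg; first exact: sqrt_continuous.
  exact: gauss_integral_proof.cvg_integral0_gauss_sqr.
rewrite sqrtrM ?pi_ge0// sqrtrV// (_ : 4 = 2 ^+ 2); last by rewrite expr2 -natrM.
rewrite sqrtr_sqr ger0_norm//.
rewrite (_ : (fun _ => Num.sqrt _) = gint)//.
by apply/funext => r; rewrite sqrtr_sqr ger0_norm// gauss_integral_proof.integral0_gauss_ge0.
Qed.

Lemma gint_ub (a : R) : 0 <= a -> gint a <= Num.sqrt pi / 2.
Proof.
move=> a0; rewrite -(cvg_lim _ cvg_gint)//; apply: limr_ge; first exact: cvgP cvg_gint.
near=> x.
by apply: gint_le => //; near: x; apply: nbhs_pinfty_ge; rewrite num_real.
Unshelve. all: end_near. Qed.

Lemma gauss_sum_ub (h : R) n : 0 <= h ->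
  \sum_(k < n) gf (k.+1%:R * h) * h <= gint (n%:R * h).
Proof.
move=> h0; elim: n => [|n IH]; first by rewrite big_ord0 mul0r gint0.
rewrite big_ord_recr /=.
have := gint_bounds (n%:R * h) (n.+1%:R * h); rewrite mulr_ge0// ler_wpM2r ?ler_nat//.
move=> /(_ isT isT) /andP[+ _]; rewrite -mulrBl -natrB// subSnn mul1r mulrC; lra.
Qed.

Lemma gauss_sum_lb (h : R) n : 0 <= h ->
  gint (n%:R * h) <= \sum_(k < n) gf (k%:R * h) * h.
Proof.
move=> h0; elim: n => [|n IH]; first by rewrite big_ord0 mul0r gint0.
rewrite big_ord_recr /=.
have := gint_bounds (n%:R * h) (n.+1%:R * h); rewrite mulr_ge0// ler_wpM2r ?ler_nat//.
move=> /(_ isT isT) /andP[_ +]; rewrite -mulrBl -natrB// subSnn mul1r mulrC; lra.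
Qed.

(** The full series is [1 / (1 - exp (- x))], at most [1 + x^-1]. The induction carries the factor
    [1 - exp (- n x)] of the partial sums. *)
Lemma geometric_sum_ub (x : R) n : 0 < x ->
  \sum_(k < n) expR (- (k%:R * x)) <= 1 + x^-1.
Proof.
move=> x0; pose c := 1 + x^-1; have c0 : 0 < c by rewrite addr_gt0 ?invr_gt0.
suff : \sum_(k < n) expR (- (k%:R * x)) <= (1 - expR (- (n%:R * x))) * c.
  move=> /le_trans; apply; rewrite -[leRHS]mul1r ler_pM2r// gerBl; exact: expR_ge0.
elim: n => [|n IH]; first by rewrite big_ord0 mul0r oppr0 expR0 subrr mul0r.
rewrite big_ord_recr /=.
rewrite (_ : - (n.+1%:R * x) = - (n%:R * x) + - x) ?expRD; last by rewrite -natr1; ring.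
set a := expR (- (n%:R * x)) in IH *; have a0 : 0 < a by exact: expR_gt0.
suff : a <= a * ((1 - expR (- x)) * c) by move: IH; lra.
rewrite ler_pMr// expRN /c.
have := expR_ge1Dx x; have e0 := expR_gt0 x; set E := expR x in e0 * => E1.
have -> : (1 - E^-1) * (1 + x^-1) = ((E - 1) * (1 + x)) / (E * x).
  by field; rewrite !gt_eqF.
by rewrite ler_pdivlMr ?mulr_gt0// mul1r; lra.
Qed.
End gauss_sums.

Section sums.
Context {R : realType}.
Local Notation gint := (@gauss_integral_proof.integral0_gauss R).
Local Notation gf := (@gauss_fun R).

Lemma near_pinfty_scale (c : R) (P : R -> Prop) : 0 < c ->
  (\forall x \near +oo, P x) -> \forall s \near +oo, P (s * c).
Proof.
move=> c0; suff : s * c @[s --> +oo] --> +oo by move=> /(_ P).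
apply/cvgryPge => A; near=> s; rewrite -ler_pdivrMr//.
Unshelve. all: end_near. Qed.

Lemma gauss_sum_le (h : R) n : 0 < h ->
  \sum_(k < n) gf (k%:R * h) <= 1 + Num.sqrt pi / 2 / h.
Proof.
move=> h0; have c0 : 0 <= Num.sqrt pi / 2 / h :> R by rewrite !divr_ge0 ?sqrtr_ge0// ltW.
case: n => [|n]; first by rewrite big_ord0 addr_ge0.
rewrite big_ord_recl /= mul0r; apply: lerD; first exact: gauss_fun_le1.
rewrite ler_pdivlMr// big_distrl/=; apply: le_trans (gauss_sum_ub _ n (ltW h0)) _.
by apply: gint_ub; rewrite mulr_ge0// ltW.
Qed.

Lemma gauss_sum_ge (h : R) n : 0 < h -> gint (n%:R * h) / h <= \sum_(k < n) gf (k%:R * h).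
Proof.
by move=> h0; rewrite ler_pdivrMr// big_distrl/=; exact: gauss_sum_lb (ltW h0).
Qed.

(** Dropping the term [k = 0] costs at most [gf 0 = 1]. This sum arises on the side of the peak
    where cells are evaluated at their far end. *)
Lemma gauss_sumS_ge (h : R) n : 0 < h ->
  gint (n%:R * h) / h - 1 <= \sum_(k < n) gf (k.+1%:R * h).
Proof.
move=> h0; have := gauss_sum_ge _ n h0.
have : \sum_(k < n.+1) gf (k%:R * h) = gf (0%:R * h) + \sum_(k < n) gf (k.+1%:R * h).
  by rewrite big_ord_recl.
rewrite big_ord_recr /=.
have := gauss_fun_le1 (0%:R * h); have := gauss_fun_ge0 (n%:R * h); lra.
Qed.

Lemma telescope_le (f b : nat -> R) n : (forall k, (k < n)%N -> f k - f k.+1 <= b k) ->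
  f 0 - f n <= \sum_(k < n) b k.
Proof.
elim: n => [|n IH] H; first by rewrite big_ord0 subrr.
rewrite big_ord_recr /=; have := H _ (ltnSn n).
by have := IH (fun k kn => H k (leqW kn)); lra.
Qed.

Lemma telescope_ge (f b : nat -> R) n : (forall k, (k < n)%N -> b k <= f k - f k.+1) ->
  \sum_(k < n) b k <= f 0 - f n.
Proof.
elim: n => [|n IH] H; first by rewrite big_ord0 subrr.
rewrite big_ord_recr /=; have := H _ (ltnSn n).
by have := IH (fun k kn => H k (leqW kn)); lra.
Qed.
Lemma near_sqrt_ge (a : R) : \forall s \near +oo, a <= Num.sqrt s.
Proof.
near=> s; have s1 : 1 <= s by near: s; apply: nbhs_pinfty_ge; rewrite num_real.
have : `|a| ^+ 2 <= s by near: s; apply: nbhs_pinfty_ge; rewrite num_real.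
move=> /ler_wsqrtr; rewrite sqrtr_sqr normr_id; apply: le_trans; exact: ler_norm.
Unshelve. all: end_near. Qed.

Lemma near_sqrtV_le (e : R) : 0 < e -> \forall s \near +oo, (Num.sqrt s)^-1 <= e.
Proof.
move=> e0; near=> s; have h : e^-1 <= Num.sqrt s by near: s; exact: near_sqrt_ge.
by rewrite -[leRHS]invrK lef_pV2// posrE ?invr_gt0// (lt_le_trans _ h)// invr_gt0.
Unshelve. all: end_near. Qed.

Lemma norm_rescale (M y : R) : 0 < M -> 0 < `|y| -> `|y * (M / `|y|)| = M.
Proof.
move=> M0 y0; rewrite !normrM normfV normr_id (gtr0_norm M0).
by rewrite mulrCA divff ?gt_eqF// mulr1.
Qed.

Lemma gauss_fun_norm (x : R) : gf `|x| = gf x.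
Proof. by rewrite /gauss_fun real_normK// num_real. Qed.

(** Chooses the cell width: the bounds valid for large [s] are continuous in [d], and only their
    value at 0 matters. *)
Lemma small_param (f : R -> R) (e : R) : {for 0, continuous f} -> 0 < e ->
  exists2 d, 0 < d <= 1 / 2 & `|f d - f 0| <= e.
Proof.
move=> /cvgrPdist_le/(_ e)/[apply] /nbhs_ballP[d /= d0 H].
exists (Num.min (d / 2) (1 / 2)); first by rewrite lt_min !divr_gt0//= ge_min lexx orbT.
rewrite distrC; apply: H; rewrite /ball /= sub0r normrN gtr0_norm ?lt_min ?divr_gt0//.
by rewrite gt_min ltr_pdivrMr// ltr_pMr// ltr1n.
Qed.

Lemma expR_sub1_le (x : R) : expR x - 1 <= x * expR x.
Proof.
have := expR_ge1Dx (- x); rewrite -(ler_pM2l (expR_gt0 x)) expRxMexpNx_1 mulrDr mulr1 mulrN.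
by rewrite [x * _]mulrC; lra.
Qed.

End sums.

(** * Asymptotics of the tail of the product *)

(* For a tail T x = h x * exp (- x), this is ln (h x). *)
Definition elog {R : realType} (T : R -> R) (x : R) : R := ln (T x) + x.

Section product_tail_asymptotics.
Context {R : realType}.
Variables lam mu : R.
Hypotheses (lam0 : 0 < lam) (mu0 : 0 < mu) (lammu : lam + mu = 1).
Variables T1 T2 : R -> R.
Hypotheses (T1_gt0 : forall x, 0 < T1 x) (T2_gt0 : forall x, 0 < T2 x).
Hypotheses (T1_le : forall x y, x <= y -> T1 y <= T1 x).
Hypotheses (T2_le : forall x y, x <= y -> T2 y <= T2 x).
Hypotheses (pT1 : potter (elog T1)) (pT2 : potter (elog T2)).
Local Notation level := (level lam mu).
Local Notation rate := (rate lam mu).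
Local Notation gf := (@gauss_fun R).
Local Notation gint := (@gauss_integral_proof.integral0_gauss R).
Implicit Types s x e M : R.

Definition threshold s x := s * level (x / s).
(* [relpeak s x] compares the product of the two tails at the point of the level
   curve above [x] with its value at the minimiser (s * lam, s * mu). *)
Definition peak s := T1 (s * lam) * T2 (s * mu).
Definition relpeak s x := T2 x * T1 (threshold s x) / peak s.
(** The Gaussian width: near the peak [s * rate (x / s)] is close to [(dev s x / kap) ^+ 2],
    matching [gf y = exp (- y ^+ 2)]. *)
Definition kap := Num.sqrt (2 * lam * mu).
Definition dev s x := (x - s * mu) / Num.sqrt s.

Lemma elogE (T : R -> R) x : 0 < T x -> T x = expR (elog T x - x).
Proof. by move=> T0; rewrite /elog addrK lnK. Qed.

Lemma peak_gt0 s : 0 < peak s.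
Proof. by rewrite mulr_gt0. Qed.

Lemma kap_gt0 : 0 < kap.
Proof. by rewrite sqrtr_gt0 !mulr_gt0. Qed.

Lemma kap_sqr : kap ^+ 2 = 2 * lam * mu.
Proof. by rewrite sqr_sqrtr// !mulr_ge0// ltW. Qed.

(** The exponential parts of the four tails combine into [x + threshold s x - s], which is
    [s * rate (x / s)]; only differences of [elog] remain. *)
Lemma relpeakE s x : 0 < s -> relpeak s x =
  expR ((elog T2 x - elog T2 (s * mu)) + (elog T1 (threshold s x) - elog T1 (s * lam))
        - s * rate (x / s)).
Proof.
move=> s0; rewrite /relpeak /peak (elogE T2 x)// (elogE T1 (threshold s x))//.
rewrite (elogE T1 (s * lam))// (elogE T2 (s * mu))//.
rewrite -!expRD -expRB; congr expR; rewrite /rate /threshold.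
have -> : s * (x / s + level (x / s) - 1) = x + s * level (x / s) - s * (lam + mu).
  by rewrite lammu; field; rewrite gt_eqF.
by ring.
Qed.

Lemma dev_ratio s x : 0 < s -> x / s = mu + dev s x / Num.sqrt s.
Proof.
move=> s0; have r0 : 0 < Num.sqrt s by rewrite sqrtr_gt0.
rewrite /dev -mulrA -invfM -expr2 sqr_sqrtr ?ltW//; field; by rewrite gt_eqF.
Qed.

Lemma rate_scaled s y d e : 0 < s -> 
  (forall x, `|x| <= d -> `|rate (mu + x) - x ^+ 2 / (2 * lam * mu)| <= e * x ^+ 2) ->
  `|y / Num.sqrt s| <= d ->
  `|s * rate (mu + y / Num.sqrt s) - (y / kap) ^+ 2| <= e * y ^+ 2.
Proof.
move=> s0 H /H; have r0 : 0 < Num.sqrt s by rewrite sqrtr_gt0.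
have rr : Num.sqrt s ^+ 2 = s by rewrite sqr_sqrtr ?ltW.
rewrite -(ler_pM2l s0) -[in leLHS](gtr0_norm s0) -normrM (gtr0_norm s0) mulrBr.
have -> : s * ((y / Num.sqrt s) ^+ 2 / (2 * lam * mu)) = (y / kap) ^+ 2.
  rewrite !expr_div_n kap_sqr rr; field; by rewrite !gt_eqF.
have -> : s * (e * (y / Num.sqrt s) ^+ 2) = e * y ^+ 2.
  by rewrite expr_div_n rr; field; rewrite gt_eqF.
exact.
Qed.

(** Continuity of [level] at [mu] is read off from [rate_quadratic], since
    [rate t = (t - mu) + (level t - lam)]. *)
Lemma cvg_level (e : R) : 0 < e -> exists2 d, 0 < d <= mu / 2 & forall t, `|t - mu| <= d ->
  `|level t - lam| <= e.
Proof.
move=> e0.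
have [d1 /andP[d10 d1m] H] := rate_quadratic _ _ lam0 mu0 lammu _ ltr01.
pose K := 1 + (d1 / (2 * lam * mu) + d1).
have K0 : 0 < K by rewrite !addr_gt0// divr_gt0// !mulr_gt0.
exists (Num.min d1 (e / K)).
  by rewrite lt_min d10 divr_gt0//= ge_min d1m.
move=> t; rewrite le_min => /andP[t1 t2].
have := H _ t1; rewrite subrKC /rate mul1r.
have -> : t + level t - 1 = (t - mu) + (level t - lam) by rewrite -lammu; ring.
set y := t - mu in t1 t2 *; set z := level t - lam => h.
have : `|y| * K <= e by rewrite -ler_pdivlMr.
suff : `|z| <= `|y| * K by move=> /le_trans; apply.
have yy : y ^+ 2 <= `|y| * d1 by rewrite -(real_normK (num_real y)) expr2 ler_wpM2l.
have c0 : 0 < (2 * lam * mu)^-1 by rewrite invr_gt0 !mulr_gt0.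
have yy2 := ler_wpM2r (ltW c0) yy.
rewrite /K; set c := (2 * lam * mu)^-1 in c0 yy2 h *.
have y2 := sqr_ge0 y; have cy := mulr_ge0 (ltW c0) y2.
rewrite !mulrDr mulr1 !mulrA.
have : - `|y| <= y <= `|y| by rewrite -ler_norml.
move: h; rewrite !ler_norml => /andP[h1 h2] /andP[h3 h4]; apply/andP; split; lra.
Qed.

Lemma relpeak_center e M : 0 < e -> 0 < M -> \forall s \near +oo, forall x,
  `|dev s x| <= M ->
  expR (- e) * gf (dev s x / kap) <= relpeak s x <= expR e * gf (dev s x / kap).
Proof.
move=> e0 M0; have e40 : 0 < e / 4 by rewrite divr_gt0.
(* For [|dev| <= M] the quadratic error [e' * dev ^+ 2] is at most [e / 2]; the two [elog]
   differences take [e / 4] each. *)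
pose e' := e / 2 / M ^+ 2; have e'0 : 0 < e' by rewrite !divr_gt0// exprn_gt0.
have [d1 d10 H1] := potter_local _ _ _ pT1 lam0 e40.
have [d2 d20 H2] := potter_local _ _ _ pT2 mu0 e40.
have [d3 /andP[d30 _] H3] := rate_quadratic _ _ lam0 mu0 lammu _ e'0.
have [d4 /andP[d40 _] H4] := cvg_level _ d10.
near=> s => x xM.
have s0 : 0 < s by near: s; apply: nbhs_pinfty_gt; rewrite num_real.
have r0 : 0 < Num.sqrt s by rewrite sqrtr_gt0.
set y := dev s x in xM *.
have small d : 0 < d -> M / Num.sqrt s <= d -> `|y / Num.sqrt s| <= d.
  move=> d0 /(le_trans _); apply; rewrite normrM normfV (gtr0_norm r0).
  by rewrite ler_pM2r ?invr_gt0.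
have small2 : `|y / Num.sqrt s| <= d2.
  apply: small => //; rewrite -ler_pdivlMl//; near: s; apply: near_sqrtV_le.
  by rewrite mulr_gt0 ?invr_gt0.
have small3 : `|y / Num.sqrt s| <= d3.
  apply: small => //; rewrite -ler_pdivlMl//; near: s; apply: near_sqrtV_le.
  by rewrite mulr_gt0 ?invr_gt0.
have small4 : `|y / Num.sqrt s| <= d4.
  apply: small => //; rewrite -ler_pdivlMl//; near: s; apply: near_sqrtV_le.
  by rewrite mulr_gt0 ?invr_gt0.
have xs : x / s = mu + y / Num.sqrt s by exact: dev_ratio.
have h2 : `|elog T2 x - elog T2 (s * mu)| <= e / 4.
  have -> : x = s * (x / s) by rewrite mulrC divfK ?gt_eqF.
  have hs : forall t, `|t - mu| <= d2 -> `|elog T2 (s * t) - elog T2 (s * mu)| <= e / 4 by near: s.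
  by apply: hs; rewrite xs addrC addKr.
have h1 : `|elog T1 (threshold s x) - elog T1 (s * lam)| <= e / 4.
  have hs : forall t, `|t - lam| <= d1 -> `|elog T1 (s * t) - elog T1 (s * lam)| <= e / 4 by
    near: s.
  by apply: hs; apply: H4; rewrite xs addrC addKr.
have h3 : `|s * rate (x / s) - (y / kap) ^+ 2| <= e / 2.
  rewrite xs; apply: (le_trans (rate_scaled _ _ _ _ s0 H3 small3)).
  rewrite /e' -mulrA; apply: ler_piMr; first by rewrite divr_ge0// ltW.
  rewrite mulrC ler_pdivrMr ?exprn_gt0// mul1r.
  by rewrite -(real_normK (num_real y)) ler_pXn2r ?nnegrE// ltW.
rewrite relpeakE// /gauss_fun -!expRD !ler_expR.
move: h1 h2 h3; rewrite !ler_norml => /andP[? ?] /andP[? ?] /andP[? ?].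
by apply/andP; split; lra.
Unshelve. all: end_near. Qed.

(** The Gaussian decay known at [|dev| = M] propagates outwards as a linear exponent by
    [rate_star_shaped]. [C] comes before [M], so [M] can later be taken large in terms of [C]. *)
Lemma relpeak_outer a : 0 < a -> exists C : R, forall M, 0 < M -> \forall s \near +oo, forall x,
  M <= `|dev s x| -> s * a <= x <= s * 3 ->
  relpeak s x <= expR C * expR (- (`|dev s x| * (M / (4 * lam * mu)))).
Proof.
move=> a0; have [C2 H2] := potter_bounded _ _ 3 _ pT2 a0 mu0.
have [C1 H1] := potter_bounded _ _ (level a) _ pT1 (level_gt0 _ _ lam0 mu0 3 (ltr0Sn _ _)) lam0.
exists (C1 + C2) => M M0.
have c0 : 0 < (4 * lam * mu)^-1 by rewrite invr_gt0 !mulr_gt0.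
have [d /andP[d0 dmu] H3] := rate_quadratic _ _ lam0 mu0 lammu _ c0.
near=> s => x xM /andP[ax xa].
have s0 : 0 < s by near: s; apply: nbhs_pinfty_gt; rewrite num_real.
have r0 : 0 < Num.sqrt s by rewrite sqrtr_gt0.
set y := dev s x in xM *.
have y0 : 0 < `|y| by rewrite (lt_le_trans M0).
have xs : x / s = mu + y / Num.sqrt s by exact: dev_ratio.
have axs : a <= x / s by rewrite ler_pdivlMr// mulrC.
have xas : x / s <= 3 by rewrite ler_pdivrMr// mulrC.
have h2 : `|elog T2 x - elog T2 (s * mu)| <= C2.
  have -> : x = s * (x / s) by rewrite mulrC divfK ?gt_eqF.
  have hs : forall t, a <= t <= 3 -> `|elog T2 (s * t) - elog T2 (s * mu)| <= C2 by near: s.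
  by apply: hs; rewrite axs.
have h1 : `|elog T1 (threshold s x) - elog T1 (s * lam)| <= C1.
  have hs : forall t, level 3 <= t <= level a -> `|elog T1 (s * t) - elog T1 (s * lam)| <= C1
    by near: s.
  apply: hs; rewrite !level_le//; exact: lt_le_trans axs.
have h3 : `|y| * (M / (4 * lam * mu)) <= s * rate (x / s).
  (* The point at deviation [M] on the same side as [y]. There the quadratic expansion still applies
     and, with half of its coefficient given up, yields [1 / (4 lam mu)]. *)
  pose z := y * (M / `|y|).
  have zM : `|z| = M by exact: norm_rescale.
  have small : `|z / Num.sqrt s| <= d.
    rewrite normrM normfV (gtr0_norm r0) zM -ler_pdivlMl//; near: s; apply: near_sqrtV_le.
    by rewrite mulr_gt0 ?invr_gt0.
  have := rate_scaled _ _ _ _ s0 H3 small.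
  have -> : (z / kap) ^+ 2 = 2 * ((4 * lam * mu)^-1 * z ^+ 2).
    by rewrite expr_div_n kap_sqr; field; rewrite !gt_eqF.
  rewrite -(real_normK (num_real z)) zM ler_norml => /andP[h _].
  have {}h : (4 * lam * mu)^-1 * M ^+ 2 <= s * rate (mu + z / Num.sqrt s) by lra.
  have a01 : 0 <= M / `|y| <= 1.
    by apply/andP; split; [rewrite divr_ge0// ltW|rewrite ler_pdivrMr// mul1r].
  have xs0 : 0 < mu + y / Num.sqrt s by rewrite -xs (lt_le_trans a0).
  have := rate_star_shaped _ _ lam0 mu0 lammu _ _ a01 xs0; rewrite -xs.
  have -> : mu + M / `|y| * (y / Num.sqrt s) = mu + z / Num.sqrt s by rewrite /z mulrA (mulrC y).
  move=> /(ler_wpM2l (ltW s0)) /(le_trans h).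
  rewrite (mulrCA s) -ler_pdivrMl ?divr_gt0// => hh; apply: le_trans hh.
  rewrite le_eqVlt; apply/orP; left; apply/eqP; field; by rewrite !gt_eqF.
rewrite relpeakE// -!expRD !ler_expR.
by move: h1 h2 h3; rewrite !ler_norml => /andP[? ?] /andP[? ?] ?; lra.
Unshelve. all: end_near. Qed.

Variable G : R -> R.

(* Up to the change of scale, [Gs s x] stands for [P(Y1 Y2 > u, X2 > x)]; these
   four facts are all that the asymptotic analysis retains of the probability
   space. *)
Definition tail_decomposition :=
  exists Gs : R -> R -> R, forall s : R, 0 < s ->
  [/\ forall x y, 0 < x -> x <= y ->
        (T2 x - T2 y) * T1 (threshold s x) <= Gs s x - Gs s y <= (T2 x - T2 y) * T1 (threshold s y),
      forall x, 0 < x -> 0 <= Gs s x <= T2 x,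
      forall x, 0 < x -> 0 <= G s - Gs s x <= T1 (threshold s x) &
      forall x, 0 < x -> T2 x * T1 (threshold s x) <= G s].

Hypothesis dec : tail_decomposition.

Let peak0 s : 0 < peak s := peak_gt0 s.
Let kap0 : 0 < kap := kap_gt0.

Lemma relpeakP s x : T2 x * T1 (threshold s x) = peak s * relpeak s x.
Proof. by rewrite mulrCA divff ?mulr1 ?gt_eqF. Qed.

(** With error 1/8 in [potter_sublinear], the left side is at most [exp (- 7 s / 4)] and the peak at
    least [exp (- 9 s / 8)]. *)
Lemma tail_edge (T : R -> R) : (forall x, 0 < T x) -> potter (elog T) ->
  \forall s \near +oo, T (s * 2) <= peak s.
Proof.
move=> T0 pT; have e0 : (0 : R) < 1 / 8 by rewrite divr_gt0.
have H := near_pinfty_scale 2 _ (ltr0Sn _ _) (potter_sublinear _ _ pT e0).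
have H1 := near_pinfty_scale lam _ lam0 (potter_sublinear _ _ pT1 e0).
have H2 := near_pinfty_scale mu _ mu0 (potter_sublinear _ _ pT2 e0).
near=> s; have s0 : 0 < s by near: s; apply: nbhs_pinfty_gt; rewrite num_real.
have h : `|elog T (s * 2)| <= 1 / 8 * (s * 2) by near: s.
have h1 : `|elog T1 (s * lam)| <= 1 / 8 * (s * lam) by near: s.
have h2 : `|elog T2 (s * mu)| <= 1 / 8 * (s * mu) by near: s.
rewrite /peak (elogE T)// (elogE T1)// (elogE T2)// -expRD ler_expR.
have -> : lam = 1 - mu by move: lammu; lra.
move: h h1 h2; have -> : lam = 1 - mu by move: lammu; lra.
rewrite !ler_norml => /andP[? ?] /andP[? ?] /andP[? ?]; nra.
Unshelve. all: end_near. Qed.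

(** [T2 (x + d) / T2 x] lies within a factor [exp (e)] of [exp (- d)]. The lower bound refers to the
    left end and the upper one to the right end, where [tail_decomposition] evaluates [T1]. *)
Lemma tail_step a d e : 0 < a -> 0 < d <= 1 -> 0 < e -> \forall s \near +oo, forall x, s * a <= x ->
  (1 - expR (e - d)) * T2 x <= T2 x - T2 (x + d) <= (expR (d + e) - 1) * T2 (x + d).
Proof.
move=> a0 /andP[d0 d1] e0; have H := potter_step _ _ _ pT2 a0 e0.
near=> s => x sx.
have h : forall x y, s * a <= x -> s * a <= y -> `|y - x| <= 1 ->
  `|elog T2 y - elog T2 x| <= e by near: s.
have sxd : s * a <= x + d by rewrite (le_trans sx)// lerDl ltW.
have := h _ _ sx sxd; rewrite [x + d]addrC addrK (gtr0_norm d0) => /(_ d1).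
rewrite ler_norml => /andP[h1 h2].
rewrite !mulrBl !mul1r lerD2l lerN2 lerD2r addrC (elogE T2 x)// (elogE T2 (x + d))//.
rewrite -!expRD !ler_expR [d + x]addrC in h1 h2 *; apply/andP; split; lra.
Unshelve. all: end_near. Qed.

Lemma dev_mulr s (k d x : R) : 0 <= k -> 0 < d -> `|x - s * mu| = k * d ->
  `|dev s x| = k * (d / Num.sqrt s).
Proof.
move=> k0 d0 H; rewrite /dev normrM H normfV ger0_norm ?sqrtr_ge0//.
by rewrite mulrA.
Qed.

(** Below [s * a] the threshold for [X1] exceeds [2 s], so [tail_edge] for [T1] closes the left end
    of the range. *)
Lemma level_eq2 : exists2 a, 0 < a < mu & level a = 2.
Proof.
pose a := mu * (lam / 2) `^ (lam / mu).
have l20 : 0 < lam / 2 by rewrite divr_gt0.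
have a0 : 0 < a by rewrite mulr_gt0// powR_gt0.
have pa : level a = 2.
  rewrite /(level _) /a mulrAC divff ?gt_eqF// mul1r -powRrM.
  rewrite (_ : lam / mu * - (mu / lam) = -1); last by field; rewrite !gt_eqF.
  rewrite powR_inv1 ?ltW//; field; by rewrite gt_eqF.
exists a => //; rewrite a0/= ltNge; apply/negP => mua.
have := level_le _ _ lam0 mu0 _ _ mu0 mua; rewrite pa level_mu//.
by move: lammu mu0; lra.
Qed.

(** The initial 2 comes from the two discarded ends, each at most one peak; the inner factor 2 from
    the two sides of the peak. *)
Lemma tail_ratio_ub : exists C : R, forall d e M, 0 < d <= 1 -> 0 < e -> 0 < M ->
  \forall s \near +oo, G s / peak s <= 2 + (expR (d + e) - 1) *
    (2 * (expR e * (1 + Num.sqrt pi / 2 / (d / Num.sqrt s / kap))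
        + expR C * (1 + (d / Num.sqrt s * (M / (4 * lam * mu)))^-1))).
Proof.
have [a1 /andP[a10 a1mu] pa1] := level_eq2.
(* The last cell on the left passes [s * a1] by at most [d <= 1]; halving [a1] leaves room for it
   once [s * a >= 1]. *)
pose a := a1 / 2; have a0 : 0 < a by rewrite divr_gt0.
have [C HC] := relpeak_outer _ a0.
exists C => d e M d01 e0 M0; have /andP[d0 d1] := d01.
have HCM := HC _ M0.
have HM := relpeak_center _ _ e0 M0.
have Hstep := tail_step _ _ _ a0 d01 e0.
have He1 := tail_edge _ T1_gt0 pT1; have He2 := tail_edge _ T2_gt0 pT2.
have [Gs HG] := dec.
near=> s.
have s1 : 1 <= s by near: s; apply: nbhs_pinfty_ge; rewrite num_real.
have sa : 1 <= s * a by rewrite -ler_pdivrMr//; near: s; apply: nbhs_pinfty_ge; rewrite num_real.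
have s0 : 0 < s by rewrite (lt_le_trans _ s1).
have r0 : 0 < Num.sqrt s by rewrite sqrtr_gt0.
have hcm : forall x, M <= `|dev s x| -> s * a <= x <= s * 3 ->
  relpeak s x <= expR C * expR (- (`|dev s x| * (M / (4 * lam * mu)))) by near: s.
have hm : forall x, `|dev s x| <= M ->
  expR (- e) * gf (dev s x / kap) <= relpeak s x <= expR e * gf (dev s x / kap) by near: s.
have hstep : forall x, s * a <= x ->
  (1 - expR (e - d)) * T2 x <= T2 x - T2 (x + d) <= (expR (d + e) - 1) * T2 (x + d) by near: s.
have he1 : T1 (s * 2) <= peak s by near: s.
have he2 : T2 (s * 2) <= peak s by near: s.
have [HG1 HG2 HG3 _] := HG s s0.
set h := d / Num.sqrt s / kap; set x0 := d / Num.sqrt s * (M / (4 * lam * mu)).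
have h0 : 0 < h by rewrite !divr_gt0.
have x00 : 0 < x0 by rewrite mulr_gt0 ?divr_gt0// !mulr_gt0.
(* The first term bounds the cells with |dev| <= M, the second one the others. *)
pose b (k : nat) := expR e * gf (k%:R * h) + expR C * expR (- (k%:R * x0)).
have b0 k : 0 <= b k by rewrite addr_ge0// mulr_ge0 ?expR_ge0// gauss_fun_ge0.
set Bd := expR e * _ + _.
have sumb n : \sum_(k < n) b k <= Bd.
  rewrite big_split /= -!big_distrr/=; apply: lerD; apply: ler_wpM2l; rewrite ?expR_ge0//.
    exact: gauss_sum_le.
  exact: geometric_sum_ub.
have sumbS n : \sum_(k < n) b k.+1 <= Bd.
  apply: le_trans (sumb n.+1); rewrite big_ord_recl /= lerDr; exact: b0.
have maj (k : nat) x : s * a <= x <= s * 3 -> `|x - s * mu| = k%:R * d -> relpeak s x <= b k.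
  move=> ax xk; have := dev_mulr _ _ _ _ (ler0n _ k) d0 xk => dk.
  have [dM|/ltW dM] := leP `|dev s x| M.
    have /andP[_ /le_trans] := hm _ dM; apply.
    rewrite -gauss_fun_norm normrM normfV (gtr0_norm kap0) dk -mulrA.
    by rewrite lerDl mulr_ge0// expR_ge0.
  apply: (le_trans (hcm _ dM ax)); rewrite dk -(mulrA k%:R) /b.
  by rewrite lerDr mulr_ge0 ?expR_ge0// gauss_fun_ge0.
set F := expR (d + e) - 1.
have F0 : 0 <= F by rewrite subr_ge0 -[leLHS]expR0 ler_expR addr_ge0// ltW.
have mu1 : mu <= 1 by move: lammu lam0; lra.
have smu : s * mu <= s by rewrite ler_piMr// ltW.
(* Each cell is bounded at its right end, which is the far end to the right of the peak and the near
   end to the left: hence [b k.+1] there and [b k] here. The lower bound reverses this. *)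
have step x : s * a <= x -> x + d <= s * 3 -> forall t, 0 < t -> forall k : nat, 
    t = x + d -> `|x + d - s * mu| = k%:R * d ->
    (T2 x - T2 t) * T1 (threshold s t) <= F * peak s * b k.
  move=> ax xd t t0 k te xk; rewrite te.
  have /andP[_ h2] := hstep _ ax.
  apply: (le_trans (ler_wpM2r (ltW (T1_gt0 _)) h2)).
  rewrite -(mulrA _ (T2 _)) relpeakP -(mulrA F); apply: ler_wpM2l => //; apply: ler_wpM2l;
    first exact: ltW.
  by apply: maj => //; rewrite xd andbT (le_trans ax)// lerDl ltW.
have amu : s * a <= s * mu by rewrite ler_pM2l// /a; move: a1mu a10; lra.
have smu0 : 0 < s * mu by rewrite mulr_gt0.
have right : Gs s (s * mu) <= peak s + F * peak s * Bd.
  (* The cells stay below [3 s], and the last point is above [3 s - d], hence above [2 s], where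
     [tail_edge] applies. *)
  pose n := Num.truncn (s * (3 - mu) / d).
  have n30 : 0 <= s * (3 - mu) / d.
    by rewrite divr_ge0 ?(ltW d0)// mulr_ge0 ?(ltW s0)// subr_ge0 (le_trans mu1)// ler1n.
  have /andP[n1 n2] := truncn_itv n30; rewrite -/n in n1 n2.
  rewrite ler_pdivlMr// in n1; rewrite ltr_pdivrMr// -[n.+1%:R]natr1 mulrDl mul1r in n2.
  have := @telescope_le _ (fun k => Gs s (s * mu + k%:R * d)) (fun k => F * peak s * b k.+1) n.
  rewrite mul0r addr0 -big_distrr/= => H.
  have H1 : Gs s (s * mu) - Gs s (s * mu + n%:R * d) <= F * peak s * (\sum_(k < n) b k.+1).
    apply: H => k kn.
    have kd : k.+1%:R * d <= s * (3 - mu).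
      by apply: le_trans n1; rewrite ler_pM2r// ler_nat.
    have kd0 : 0 <= k%:R * d by rewrite mulr_ge0// ltW.
    have ek : s * mu + k.+1%:R * d = s * mu + k%:R * d + d by rewrite -natr1; ring.
    have v0 : 0 < s * mu + k%:R * d by rewrite (lt_le_trans smu0)// lerDl.
    have v1 : s * mu + k%:R * d <= s * mu + k.+1%:R * d by rewrite ek lerDl ltW.
    have /andP[_ /le_trans] := HG1 _ _ v0 v1; apply; apply: step => //.
    - by rewrite (le_trans amu)// lerDl.
    - by rewrite -ek; move: kd; lra.
    - exact: lt_le_trans v1.
    - by rewrite -ek addrC addKr ger0_norm// mulr_ge0// ltW.
  have v2 : s * 2 <= s * mu + n%:R * d by move: n2 s1 d1; lra.
  have /andP[_ H2] := HG2 (s * mu + n%:R * d) (lt_le_trans (mulr_gt0 s0 (ltr0Sn _ _)) v2).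
  have H3 := T2_le _ _ v2.
  have : F * peak s * (\sum_(k < n) b k.+1) <= F * peak s * Bd.
    by apply: ler_wpM2l => //; rewrite mulr_ge0// ltW.
  by move: he2; lra.
have left : G s - Gs s (s * mu) <= peak s + F * peak s * Bd.
  pose n := (Num.truncn (s * (mu - a1) / d)).+1.
  have n30 : 0 <= s * (mu - a1) / d.
    by rewrite divr_ge0 ?(ltW d0)// mulr_ge0 ?(ltW s0)// subr_ge0 ltW.
  have /andP[n1 n2] := truncn_itv n30; rewrite -/n in n1 n2.
  rewrite ler_pdivlMr// in n1; rewrite ltr_pdivrMr// in n2.
  have := @telescope_le _ (fun k => - Gs s (s * mu - k%:R * d)) (fun k => F * peak s * b k) n.
  rewrite mul0r subr0 -big_distrr/= => H.
  have nlow : s * a <= s * mu - n%:R * d.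
    have : n%:R * d <= s * (mu - a1) + d by rewrite /n -natr1 mulrDl mul1r lerD2r.
    by move: sa; rewrite /a; move: d1; lra.
  have H1 : - Gs s (s * mu) - - Gs s (s * mu - n%:R * d) <= F * peak s * (\sum_(k < n) b k).
    apply: H => k kn.
    have kd : k.+1%:R * d <= n%:R * d by rewrite ler_pM2r// ler_nat.
    have kd0 : 0 <= k%:R * d by rewrite mulr_ge0// ltW.
    have ek : s * mu - k%:R * d = s * mu - k.+1%:R * d + d by rewrite -natr1; ring.
    have av : s * a <= s * mu - k.+1%:R * d by apply: (le_trans nlow); rewrite lerD2l lerN2.
    have v0 : 0 < s * mu - k.+1%:R * d by rewrite (lt_le_trans _ av)// mulr_gt0.
    have v1 : s * mu - k.+1%:R * d <= s * mu - k%:R * d by rewrite ek lerDl ltW.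
    rewrite opprK addrC.
    have /andP[_ /le_trans] := HG1 _ _ v0 v1; apply; apply: step => //.
    - by rewrite -ek; move: smu kd0 s0; lra.
    - exact: lt_le_trans v1.
    - by rewrite -ek addrAC subrr sub0r normrN ger0_norm.
  have v2 : s * mu - n%:R * d <= s * a1 by move: n2; lra.
  have v0 : 0 < s * mu - n%:R * d by rewrite (lt_le_trans _ nlow)// mulr_gt0.
  have /andP[_ H2] := HG3 _ v0.
  have H3 : T1 (threshold s (s * mu - n%:R * d)) <= T1 (s * 2).
    apply: T1_le; rewrite /threshold ler_pM2l// -pa1; apply: level_le => //.
      by rewrite divr_gt0.
    by rewrite ler_pdivrMr// (mulrC a1).
  have : F * peak s * (\sum_(k < n) b k) <= F * peak s * Bd.
    by apply: ler_wpM2l => //; rewrite mulr_ge0// ltW.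
  by move: he1; lra.
rewrite ler_pdivrMr//; move: right left; set FF := F * peak s * Bd.
rewrite (_ : (2 + F * (2 * Bd)) * peak s = 2 * peak s + 2 * FF); last by rewrite /FF; ring.
lra.
Unshelve. all: end_near. Qed.

Lemma tail_ratio_lb d e M : 0 < d <= 1 -> 0 < e -> e <= d -> kap <= M -> \forall s \near +oo,
  (1 - expR (e - d)) * (expR (- e) *
    (2 * (gint (M / kap - 1) / (d / Num.sqrt s / kap)) - 1)) <= G s / peak s.
Proof.
move=> d01 e0 ed kM; have /andP[d0 d1] := d01; have M0 := lt_le_trans kap0 kM.
pose a := mu / 2; have a0 : 0 < a by rewrite divr_gt0.
have HM := relpeak_center _ _ e0 M0.
have Hstep := tail_step _ _ _ a0 d01 e0.
have [Gs HG] := dec.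
near=> s.
have s1 : 1 <= s by near: s; apply: nbhs_pinfty_ge; rewrite num_real.
have s0 : 0 < s by rewrite (lt_le_trans _ s1).
have r0 : 0 < Num.sqrt s by rewrite sqrtr_gt0.
have rr : Num.sqrt s * Num.sqrt s = s by rewrite -expr2 sqr_sqrtr// ltW.
have rM : M / a <= Num.sqrt s by near: s; exact: near_sqrt_ge.
have rk : kap^-1 <= Num.sqrt s by near: s; exact: near_sqrt_ge.
have hm : forall x, `|dev s x| <= M ->
  expR (- e) * gf (dev s x / kap) <= relpeak s x <= expR e * gf (dev s x / kap) by near: s.
have hstep : forall x, s * a <= x ->
  (1 - expR (e - d)) * T2 x <= T2 x - T2 (x + d) <= (expR (d + e) - 1) * T2 (x + d) by near: s.
have [HG1 HG2 HG3 _] := HG s s0.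
set h := d / Num.sqrt s / kap.
have h0 : 0 < h by rewrite !divr_gt0.
pose b (k : nat) := expR (- e) * gf (k%:R * h).
(* The largest number of cells with [|dev| <= M]. Truncation loses at most [h <= 1] in the Gaussian
   variable, whence [gint (M / kap - 1)]. *)
pose n := Num.truncn (M * Num.sqrt s / d).
have n0 : 0 <= M * Num.sqrt s / d by rewrite divr_ge0 ?(ltW d0)// mulr_ge0 ?(ltW M0)// ltW.
have /andP[n1 n2] := truncn_itv n0; rewrite -/n in n1 n2.
rewrite ler_pdivlMr// in n1; rewrite ltr_pdivrMr// -[n.+1%:R]natr1 mulrDl mul1r in n2.
have Msa : M * Num.sqrt s <= s * a.
  rewrite ler_pdivrMr// in rM; apply: (le_trans (ler_wpM2r (ltW r0) rM)).
  by rewrite mulrAC rr.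
have nle k : (k <= n)%N -> k%:R * d <= M * Num.sqrt s.
  by move=> kn; apply: le_trans n1; rewrite ler_pM2r// ler_nat.
have min (k : nat) x : (k <= n)%N -> `|x - s * mu| = k%:R * d -> b k <= relpeak s x.
  move=> kn xk; have dk := dev_mulr _ _ _ _ (ler0n _ k) d0 xk.
  have dM : `|dev s x| <= M.
    by rewrite dk mulrA ler_pdivrMr//; exact: nle.
  have /andP[+ _] := hm _ dM; apply: le_trans.
  by rewrite -(gauss_fun_norm (dev s x / kap)) normrM normfV (gtr0_norm kap0) dk -(mulrA k%:R).
have sa2 : s * mu - s * a = s * a by rewrite /a; field.
have low (k : nat) : (k <= n)%N -> s * a <= s * mu - k%:R * d.
  by move=> /nle kn; move: Msa kn sa2; lra.
set F := 1 - expR (e - d).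
have F0 : 0 <= F by rewrite subr_ge0 -[leRHS]expR0 ler_expR subr_le0.
have sa0 : 0 < s * a by rewrite mulr_gt0.
have gn : gint (M / kap - 1) <= gint (n%:R * h).
  apply: gint_le; first by rewrite subr_ge0 ler_pdivlMr// mul1r.
  rewrite lerBlDr /h !mulrA -(ler_pM2r kap0) divfK ?gt_eqF// mulrDl divfK ?gt_eqF// mul1r.
  rewrite -lerBlDr ler_pdivlMr// mulrBl.
  have : 1 <= kap * Num.sqrt s by rewrite -ler_pdivrMl// mulr1.
  by move: n2 d1; lra.
have gnh : gint (M / kap - 1) / h <= gint (n%:R * h) / h by rewrite ler_pM2r ?invr_gt0.
have step x (k : nat) t : s * a <= x -> (k <= n)%N -> t = x + d ->
    `|x - s * mu| = k%:R * d ->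
    F * peak s * b k <= (T2 x - T2 t) * T1 (threshold s x).
  move=> ax kn te xk; rewrite te; have /andP[h2 _] := hstep _ ax.
  apply: le_trans (ler_wpM2r (ltW (T1_gt0 _)) h2).
  rewrite -(mulrA _ (T2 _)) relpeakP -(mulrA F); apply: ler_wpM2l => //.
  by apply: ler_wpM2l; [exact: ltW|exact: min].
have right : F * peak s * (\sum_(k < n) b k) <= Gs s (s * mu).
  have := @telescope_ge _ (fun k => Gs s (s * mu + k%:R * d)) (fun k => F * peak s * b k) n.
  rewrite mul0r addr0 -big_distrr/= => H.
  have H1 : F * peak s * (\sum_(k < n) b k) <= Gs s (s * mu) - Gs s (s * mu + n%:R * d).
    apply: H => k kn.
    have kd0 : 0 <= k%:R * d by rewrite mulr_ge0// ltW.
    have ek : s * mu + k.+1%:R * d = s * mu + k%:R * d + d by rewrite -natr1; ring.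
    have av : s * a <= s * mu + k%:R * d by rewrite (le_trans (low 0%N _))// mul0r subr0 lerDl.
    have v0 : 0 < s * mu + k%:R * d by rewrite (lt_le_trans sa0).
    have v1 : s * mu + k%:R * d <= s * mu + k.+1%:R * d by rewrite ek lerDl ltW.
    have /andP[h2 _] := HG1 _ _ v0 v1; apply: le_trans h2.
    apply: step => //; first exact: ltnW.
    by rewrite addrC addKr ger0_norm.
  have v0 : 0 < s * mu + n%:R * d.
    by rewrite ltr_wpDr ?mulr_gt0// mulr_ge0// ltW.
  have /andP[H2 _] := HG2 _ v0; move: H1; lra.
have left : F * peak s * (\sum_(k < n) b k.+1) <= G s - Gs s (s * mu).
  have := @telescope_ge _ (fun k => - Gs s (s * mu - k%:R * d)) (fun k => F * peak s * b k.+1) n.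
  rewrite mul0r subr0 -big_distrr/= => H.
  have H1 : F * peak s * (\sum_(k < n) b k.+1) <= - Gs s (s * mu) - - Gs s (s * mu - n%:R * d).
    apply: H => k kn.
    have kd0 : 0 <= k.+1%:R * d by rewrite mulr_ge0// ltW.
    have ek : s * mu - k%:R * d = s * mu - k.+1%:R * d + d by rewrite -[k.+1%:R]natr1; ring.
    have av := low _ kn.
    have v0 : 0 < s * mu - k.+1%:R * d by rewrite (lt_le_trans sa0).
    have v1 : s * mu - k.+1%:R * d <= s * mu - k%:R * d by rewrite ek lerDl ltW.
    rewrite opprK addrC; have /andP[h2 _] := HG1 _ _ v0 v1; apply: le_trans h2.
    apply: step => //.
    by rewrite addrAC subrr sub0r normrN ger0_norm.
  have v0 : 0 < s * mu - n%:R * d by rewrite (lt_le_trans sa0)// low.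
  have /andP[H2 _] := HG3 _ v0; move: H1; lra.
rewrite ler_pdivlMr//.
have sum1 : gint (M / kap - 1) / h <= \sum_(k < n) gf (k%:R * h).
  exact: (le_trans gnh (gauss_sum_ge _ _ h0)).
have sum2 : gint (M / kap - 1) / h - 1 <= \sum_(k < n) gf (k.+1%:R * h).
  by apply: le_trans (gauss_sumS_ge _ _ h0); rewrite lerD2r.
rewrite -big_distrr/= in right; rewrite -big_distrr/= in left.
have Fp : 0 <= F * peak s * expR (- e) by rewrite !mulr_ge0 ?expR_ge0// ltW.
have := ler_wpM2l Fp (lerD sum1 sum2); rewrite mulrDr.
move: right left; rewrite !mulrA; lra.
Unshelve. all: end_near. Qed.

Lemma tail_ratio_limsup e : 0 < e ->
  \forall s \near +oo, G s / peak s / Num.sqrt s <= kap * Num.sqrt pi + e.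
Proof.
move=> e0; set K := kap * Num.sqrt pi.
have K0 : 0 <= K by rewrite mulr_ge0 ?sqrtr_ge0// ltW.
pose f d : R := d + (1 + d) * (expR (2 * d) * (expR d * K + 3 * d)).
have fc : {for 0, continuous f}.
  apply: cvgD; first exact: cvg_id.
  apply: cvgM; first by apply: cvgD; [exact: cvg_cst|exact: cvg_id].
  apply: cvgM.
    have h2 : {for 0, continuous (fun x : R => 2 * x)} by apply: cvgM; [exact: cvg_cst|exact:
      cvg_id].
    by apply: (continuous_comp h2); exact: continuous_expR.
  apply: cvgD; first by apply: cvgM; [exact: continuous_expR|exact: cvg_cst].
  by apply: cvgM; [exact: cvg_cst|exact: cvg_id].
have [d /andP[d0 d12]] := small_param _ _ fc e0.
rewrite {2}/f !mulr0 expR0 !(add0r, addr0, mul1r) ler_norml => /andP[_ fd].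
have d1 : d <= 1 by move: d12; lra.
have [C HC] := tail_ratio_ub.
have dd0 : 0 < d ^+ 2 by rewrite exprn_gt0.
(* With this [M] the outer geometric sum contributes [r / 2], [r] being the root of [s], on each
   side; times [exp (d + d ^+ 2) - 1], of order [d], it is negligible. *)
pose M := 8 * expR C * lam * mu / d.
have eC := expR_gt0 C.
have M0 : 0 < M by rewrite divr_gt0// !mulr_gt0.
have d01 : 0 < d <= 1 by rewrite d0.
have H := HC d (d ^+ 2) M d01 dd0 M0.
near=> s; have s0 : 0 < s by near: s; apply: nbhs_pinfty_gt; rewrite num_real.
have r0 : 0 < Num.sqrt s by rewrite sqrtr_gt0.
have h : G s / peak s <= 2 + (expR (d + d ^+ 2) - 1) *
    (2 * (expR (d ^+ 2) * (1 + Num.sqrt pi / 2 / (d / Num.sqrt s / kap))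
        + expR C * (1 + (d / Num.sqrt s * (M / (4 * lam * mu)))^-1))) by near: s.
have r1 : 2 / d <= Num.sqrt s by near: s; exact: near_sqrt_ge.
have r2 : 2 * expR (d ^+ 2) <= Num.sqrt s by near: s; exact: near_sqrt_ge.
have r3 : 2 * expR C <= Num.sqrt s by near: s; exact: near_sqrt_ge.
apply: (@le_trans _ _ (f d)); last by move: fd; lra.
set r := Num.sqrt s in r0 h r1 r2 r3 *.
rewrite ler_pdivrMr//; apply: (le_trans h).
have -> : Num.sqrt pi / 2 / (d / r / kap) = K * r / (2 * d).
  by rewrite /K; field; rewrite !gt_eqF.
have -> : (d / r * (M / (4 * lam * mu)))^-1 = r / (2 * expR C).
  by rewrite /M; field; rewrite !gt_eqF.
set q := expR (d + d ^+ 2) - 1.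
set E := expR (d ^+ 2) in r2 *.
have dd : d ^+ 2 <= d by rewrite expr2 ler_piMr// ltW.
have q0 : 0 <= q by rewrite subr_ge0 -[leLHS]expR0 ler_expR addr_ge0// ltW.
have qd : q <= d * ((1 + d) * expR (2 * d)).
  apply: (le_trans (expR_sub1_le _)).
  have -> : d + d ^+ 2 = d * (1 + d) by ring.
  rewrite mulrA; apply: ler_wpM2l; first by rewrite mulr_ge0 ?addr_ge0// ltW.
  by rewrite ler_expR; move: dd d0; nra.
have Ed : E <= expR d by rewrite ler_expR.
have -> : 2 * (E * (1 + K * r / (2 * d)) + expR C * (1 + r / (2 * expR C)))
   = 2 * E + E * K * r / d + 2 * expR C + r.
  by field; rewrite !gt_eqF.
rewrite ler_pdivrMr// in r1.
have Kr : E * K * r / d <= expR d * K * r / d.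
  by rewrite ler_pM2r ?invr_gt0// ler_wpM2r ?(ltW r0)// ler_wpM2r.
have X0 : 0 <= expR d * K * r / d + 3 * r.
  by rewrite addr_ge0 ?divr_ge0 ?mulr_ge0 ?expR_ge0// ltW.
have s1 : q * (2 * E + E * K * r / d + 2 * expR C + r) <= q * (expR d * K * r / d + 3 * r).
  by apply: ler_wpM2l => //; lra.
have s2 := ler_wpM2r X0 qd.
have -> : f d * r = d * r + d * ((1 + d) * expR (2 * d)) * (expR d * K * r / d + 3 * r).
  by rewrite /f; field; rewrite gt_eqF.
by move: s1 s2 r1; rewrite [r * d]mulrC; lra.
Unshelve. all: end_near. Qed.

Lemma tail_ratio_liminf e : 0 < e ->
  \forall s \near +oo, kap * Num.sqrt pi - e <= G s / peak s / Num.sqrt s.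
Proof.
move=> e0; set K := kap * Num.sqrt pi.
have K0 : 0 < K by rewrite mulr_gt0// sqrtr_gt0 pi_gt0.
pose f d : R := (1 - d) * (expR (- d) * (expR (- d) * (K - (2 * kap + 1) * d))).
have ec : {for 0, continuous (fun x : R => expR (- x))}.
  have h2 : {for 0, continuous (fun x : R => - x)} by apply: cvgN; exact: cvg_id.
  by apply: (continuous_comp h2); exact: continuous_expR.
have fc : {for 0, continuous f}.
  apply: cvgM; first by apply: cvgB; [exact: cvg_cst|exact: cvg_id].
  apply: cvgM; first exact: ec.
  apply: cvgM; first exact: ec.
  apply: cvgB; first exact: cvg_cst.
  by apply: cvgM; [exact: cvg_cst|exact: cvg_id].
(* The cap [K / 2] makes [f d] positive, hence [K - (2 * kap + 1) * d >= 0], which multiplying the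
   inequalities requires. *)
have e'0 : 0 < Num.min e (K / 2) by rewrite lt_min e0 divr_gt0.
have [d /andP[d0 d12]] := small_param _ _ fc e'0.
rewrite {2}/f !(oppr0, mulr0, expR0, addr0, mul1r) le_min !ler_norml.
move=> /andP[/andP[fd _] /andP[fd2 _]].
have d1 : d <= 1 by move: d12; lra.
have d01 : 0 < d <= 1 by rewrite d0.
have dd0 : 0 < d ^+ 2 by rewrite exprn_gt0.
have dd : d ^+ 2 <= d by rewrite expr2 ler_piMr// ltW.
have fd0 : 0 < f d by move: fd2 K0; lra.
have Kd : 0 <= K - (2 * kap + 1) * d.
  rewrite leNgt; apply/negP => neg; move: fd0; rewrite ltNge => /negP; apply.
  by rewrite /f mulr_ge0_le0 ?subr_ge0// mulr_ge0_le0 ?expR_ge0// mulr_ge0_le0 ?expR_ge0// ltW.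
have [X X0 HX] : exists2 X : R, 0 <= X & Num.sqrt pi / 2 - d <= gint X.
  have /cvgrPdist_le/(_ d d0) hg := @cvg_gint R.
  have : \forall x \near +oo, 0 <= x /\ `|Num.sqrt pi / 2 - gint x| <= d.
    apply: filterI; last exact: hg.
    by apply: nbhs_pinfty_ge; rewrite num_real.
  move=> /filter_ex[X [X0]]; rewrite ler_norml => /andP[_ h]; exists X => //; move: h; lra.
pose M := kap * (X + 1).
have kM : kap <= M by rewrite /M ler_peMr ?(ltW kap0)// lerDr.
have H := tail_ratio_lb d (d ^+ 2) M d01 dd0 dd kM.
near=> s; have s0 : 0 < s by near: s; apply: nbhs_pinfty_gt; rewrite num_real.
have r0 : 0 < Num.sqrt s by rewrite sqrtr_gt0.
have h : (1 - expR (d ^+ 2 - d)) * (expR (- d ^+ 2) *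
    (2 * (gint (M / kap - 1) / (d / Num.sqrt s / kap)) - 1)) <= G s / peak s by near: s.
have r1 : 1 <= Num.sqrt s by near: s; exact: near_sqrt_ge.
apply: (@le_trans _ _ (f d)); first by move: fd; lra.
set r := Num.sqrt s in r0 h r1 *.
rewrite ler_pdivlMr//; apply: le_trans h.
have -> : M / kap - 1 = X by rewrite /M; field; rewrite gt_eqF.
set q := 1 - expR _.
have qd : d * ((1 - d) * expR (- d)) <= q.
  have := expR_sub1_le (d ^+ 2 - d); rewrite -/q => h1.
  have : (d - d ^+ 2) * expR (d ^+ 2 - d) <= q by rewrite /q; move: h1; lra.
  apply: le_trans; have -> : d - d ^+ 2 = d * (1 - d) by ring.
  rewrite mulrA; apply: ler_wpM2l; first by rewrite mulr_ge0 ?subr_ge0// ltW.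
  by rewrite ler_expR lerDr ltW.
have Ed : expR (- d) <= expR (- d ^+ 2) by rewrite ler_expR lerN2.
(* The loss [2 * kap * d] comes from replacing the full integral by [gint X], the loss [d] from the
   subtracted 1. *)
have g1 : (K - (2 * kap + 1) * d) * r / d <= 2 * (gint X / (d / r / kap)) - 1.
  have -> : 2 * (gint X / (d / r / kap)) - 1 = (2 * gint X * kap * r - d) / d.
    by field; rewrite !gt_eqF.
  rewrite ler_pM2r ?invr_gt0//.
  have h1 : (Num.sqrt pi - 2 * d) * (kap * r) <= (2 * gint X) * (kap * r).
    by rewrite ler_pM2r ?mulr_gt0//; move: HX; lra.
  have h2 : d <= d * r by rewrite ler_peMr// ltW.
  rewrite /K; move: h1 h2; rewrite !mulrBl; lra.
have Kr : 0 <= (K - (2 * kap + 1) * d) * r / d by rewrite divr_ge0 ?mulr_ge0// ltW.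
have s1 := ler_pM (expR_ge0 _) Kr Ed g1.
have s2 : 0 <= d * ((1 - d) * expR (- d)) by rewrite mulr_ge0 ?(ltW d0)// mulr_ge0 ?expR_ge0//
  subr_ge0.
have s3 : 0 <= expR (- d) * ((K - (2 * kap + 1) * d) * r / d) by rewrite mulr_ge0 ?expR_ge0.
have := ler_pM s2 s3 qd s1; apply: le_trans.
rewrite le_eqVlt; apply/orP; left; apply/eqP; rewrite /f; field; by rewrite gt_eqF.
Unshelve. all: end_near. Qed.

Theorem tail_ratio_cvg :
  G s / peak s / Num.sqrt s @[s --> +oo] --> kap * Num.sqrt pi.
Proof.
apply/cvgrPdist_le => e e0; near=> s.
have h1 : G s / peak s / Num.sqrt s <= kap * Num.sqrt pi + e by near: s; exact: tail_ratio_limsup.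
have h2 : kap * Num.sqrt pi - e <= G s / peak s / Num.sqrt s by near: s; exact: tail_ratio_liminf.
by rewrite ler_norml; apply/andP; split; lra.
Unshelve. all: end_near. Qed.

End product_tail_asymptotics.

(** * Logarithmic asymptotics of the product *)

Section log_tail_cvg.
Context {R : realType}.
Variables lam mu : R.
Hypotheses (lam0 : 0 < lam) (mu0 : 0 < mu) (lammu : lam + mu = 1).
Variables T1 T2 G : R -> R.
Hypotheses (T1_gt0 : forall x, 0 < T1 x) (T2_gt0 : forall x, 0 < T2 x).
Hypothesis dec : tail_decomposition lam mu T1 T2 G.
Local Notation level := (level lam mu).
Implicit Types s x e : R.

Lemma log_tail_ub (T : R -> R) (e : R) : (forall x, 0 < T x) -> 
  ln (T x) / x @[x --> +oo] --> (- 1 : R) -> 0 < e ->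
  exists2 x0, 0 < x0 & forall x, x0 <= x -> T x <= expR (- ((1 - e) * x)).
Proof.
move=> T0 /cvgrPdist_le H /H [x1 [_ H1]].
exists (Num.max (x1 + 1) 1); first by rewrite lt_max ltr01 orbT.
move=> x; rewrite ge_max => /andP[xx x1le]; have x0 : 0 < x by rewrite (lt_le_trans _ x1le).
have := H1 x; rewrite (lt_le_trans _ xx) ?ltrDl// => /(_ isT).
rewrite ler_norml => /andP[h _].
have : ln (T x) / x <= - (1 - e) by lra.
by rewrite ler_pdivrMr// mulNr => h2; rewrite -[T x]lnK ?posrE// ler_expR.
Qed.

(** The grid is [s * k / N]. One factor [1 - N^-1] is the error in the tails, the other the mesh
    lost when [t + level t >= 1] is used with the two ends of a cell; [N.-1] cells and two ends give
    [N.+1] terms. *)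
Lemma log_upper (N : nat) : (0 < N)%N ->
  ln (T1 x) / x @[x --> +oo] --> (- 1 : R) -> ln (T2 x) / x @[x --> +oo] --> (- 1 : R) ->
  \forall s \near +oo, G s <= N.+1%:R * expR (- ((1 - N%:R^-1) * ((1 - N%:R^-1) * s))).
Proof.
move=> N0 h1 h2; set a : R := N%:R^-1.
have N0R : 0 < N%:R :> R by rewrite ltr0n.
have a0 : 0 < a by rewrite invr_gt0.
have a1 : a <= 1 by rewrite invf_le1// ler1n.
have [y1 y10 H1] := log_tail_ub _ _ T1_gt0 h1 a0.
have [y2 y20 H2] := log_tail_ub _ _ T2_gt0 h2 a0.
have [Gs HG] := dec.
have p10 : 0 < level 1 by exact: level_gt0.
near=> s; have s0 : 0 < s by near: s; apply: nbhs_pinfty_gt; rewrite num_real.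
have sy1 : y1 <= s * level 1 by rewrite -ler_pdivrMr//; near: s; apply: nbhs_pinfty_ge;
  rewrite num_real.
have sy2 : y2 <= s * a by rewrite -ler_pdivrMr//; near: s; apply: nbhs_pinfty_ge; rewrite num_real.
have [HG1 HG2 HG3 _] := HG s s0.
pose x k : R := s * (k%:R * a).
have xs k : x k / s = k%:R * a by rewrite /x mulrAC divff ?gt_eqF// mul1r.
have x0 k : (0 < k)%N -> s * a <= x k.
  by move=> k0; rewrite /x ler_pM2l// ler_peMl ?ler1n// ltW.
set E := expR _.
have T1b k : (0 < k <= N)%N -> T1 (threshold lam mu s (x k)) <= expR (- ((1 - a) * (s * level
  (k%:R * a)))).
  move=> /andP[k0 kN]; rewrite /threshold xs; apply: H1; apply: (le_trans sy1).
  rewrite ler_pM2l//; apply: level_le => //; first by rewrite mulr_gt0 ?ltr0n.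
  by rewrite ler_pdivrMr// mul1r ler_nat.
have T2b k : (0 < k)%N -> T2 (x k) <= expR (- ((1 - a) * x k)).
  by move=> k0; apply: H2; rewrite (le_trans sy2)// x0.
have rt t : 0 < t -> 1 - t <= level t.
  by move=> t0; have := rate_ge0 _ _ lam0 mu0 lammu _ t0; rewrite /rate; lra.
have sa0 : 0 < s * a by rewrite mulr_gt0.
have term k : (0 < k < N)%N -> (T2 (x k) - T2 (x k.+1)) * T1 (threshold lam mu s (x k.+1)) <= E.
  move=> /andP[k0 kN]; apply: (@le_trans _ _ (T2 (x k) * T1 (threshold lam mu s (x k.+1)))).
    by apply: ler_wpM2r; [exact: ltW|rewrite gerBl; exact: ltW].
  apply: (le_trans (ler_pM (ltW (T2_gt0 _)) (ltW (T1_gt0 _)) (T2b _ k0) (T1b k.+1 kN))).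
  rewrite -expRD ler_expR -opprD lerN2 -mulrDr; apply: ler_wpM2l; first by rewrite subr_ge0.
  rewrite mulrC /x -mulrDr; apply: ler_wpM2l; first exact: ltW.
  have := rt (k.+1%:R * a); rewrite mulr_gt0 ?ltr0n// => /(_ isT).
  have -> : k.+1%:R * a = k%:R * a + a by rewrite -natr1; ring.
  lra.
have E1 : T1 (threshold lam mu s (x 1%N)) <= E.
  apply: (le_trans (T1b 1%N _)); first by [].
  rewrite ler_expR lerN2; apply: ler_wpM2l; first by rewrite subr_ge0.
  by rewrite mulrC ler_pM2l// mul1r; exact: rt.
have E2 : T2 (x N) <= E.
  apply: (le_trans (T2b N N0)).
  rewrite ler_expR lerN2; apply: ler_wpM2l; first by rewrite subr_ge0.
  by rewrite mulrC /x ler_pM2l// divff ?gt_eqF// gerBl ltW.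
have xpos k : (0 < k)%N -> 0 < x k by move=> k0; rewrite (lt_le_trans sa0)// x0.
have /andP[_ e1] := HG3 _ (xpos 1%N isT).
have /andP[_ e2] := HG2 _ (xpos N N0).
have := @telescope_le _ (fun k => Gs s (x k.+1)) (fun=> E) N.-1.
rewrite prednK// sumr_const card_ord => e3.
have {}e3 : Gs s (x 1%N) - Gs s (x N) <= E *+ N.-1.
  apply: e3 => k kN; have xk : x k.+1 <= x k.+2 by rewrite /x ler_pM2l// ler_pM2r// ler_nat.
  have kN2 : (0 < k.+1 < N)%N by rewrite /= -ltn_predRL.
  have /andP[_ /le_trans] := HG1 _ _ (xpos k.+1 isT) xk; apply; exact: term.
rewrite -[N.+1](_ : (N.-1 + 2)%N = _); last by rewrite addn2 prednK.
by rewrite natrD mulrDl -mulr_natl in e3 *; move: e1 e2 e3 E1 E2; lra.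
Unshelve. all: end_near. Qed.

Lemma log_tail_cvg :
  ln (T1 x) / x @[x --> +oo] --> (- 1 : R) -> ln (T2 x) / x @[x --> +oo] --> (- 1 : R) ->
  ln (G s) / s @[s --> +oo] --> (- 1 : R).
Proof.
move=> h1 h2; apply/cvgrPdist_le => e e0.
have G0 s : 0 < s -> T2 (s * mu) * T1 (s * lam) <= G s.
  move=> s0; have [Gs HG] := dec; have [_ _ _ H] := HG s s0.
  have := H (s * mu) (mulr_gt0 s0 mu0).
  by rewrite /threshold (mulrC s) mulfK ?gt_eqF// level_mu// (mulrC mu).
have e20 : 0 < e / 2 by rewrite divr_gt0.
have /cvgrPdist_le/(_ _ e20)/(near_pinfty_scale _ _ lam0) l1 := h1.
have /cvgrPdist_le/(_ _ e20)/(near_pinfty_scale _ _ mu0) l2 := h2.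
(* Then [2 / N <= e / 2]; the other half of [e] absorbs [ln N.+1 / s]. *)
pose N := (Num.truncn (4 / e)).+1.
have Ne : 4 / e <= N%:R by rewrite ltW//; case/andP: (truncn_itv (ltW (divr_gt0 (ltr0Sn R 3) e0))).
have lu := log_upper N isT h1 h2.
near=> s; have s0 : 0 < s by near: s; apply: nbhs_pinfty_gt; rewrite num_real.
have Gs0 : 0 < G s by rewrite (lt_le_trans _ (G0 s s0))// mulr_gt0.
have g1 : `| -1 - ln (T1 (s * lam)) / (s * lam)| <= e / 2 by near: s.
have g2 : `| -1 - ln (T2 (s * mu)) / (s * mu)| <= e / 2 by near: s.
have g3 : G s <= N.+1%:R * expR (- ((1 - N%:R^-1) * ((1 - N%:R^-1) * s))) by near: s.
have sl : ln N.+1%:R <= e / 2 * s.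
  by rewrite -ler_pdivrMl//; near: s; apply: nbhs_pinfty_ge; rewrite num_real.
have N0R : 0 < N%:R :> R by rewrite ltr0n.
set a : R := N%:R^-1 in g3.
have a0 : 0 < a by rewrite invr_gt0.
have ae : a <= e / 4.
  by rewrite /a -[leRHS]invrK lef_pV2 ?posrE ?invr_gt0 ?divr_gt0// invf_div.
rewrite ler_norml; apply/andP; split; last first.
  rewrite lerBlDl -lerBlDr ler_pdivlMr//.
  have := G0 s s0; rewrite -ler_ln ?posrE ?mulr_gt0// lnM ?posrE//; apply: le_trans.
  move: g1 g2; rewrite !ler_norml => /andP[_ g1] /andP[_ g2].
  have {}g1 : - 1 - e / 2 <= ln (T1 (s * lam)) / (s * lam) by lra.
  have {}g2 : - 1 - e / 2 <= ln (T2 (s * mu)) / (s * mu) by lra.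
  rewrite ler_pdivlMr ?mulr_gt0// in g1; rewrite ler_pdivlMr ?mulr_gt0// in g2.
  have -> : (-1 - e) * s = (- 1 - e / 2) * (s * lam) + (- 1 - e / 2) * (s * mu) - e / 2 * s.
    by rewrite -mulrDr -(mulrDr s) lammu mulr1; field.
  have := mulr_gt0 e20 s0; lra.
rewrite lerBrDl -lerBrDr ler_pdivrMr//.
move: g3; rewrite -ler_ln ?posrE ?mulr_gt0 ?expR_gt0// lnM ?posrE ?expR_gt0// expRK => g3.
apply: (le_trans g3).
have as' : a * s <= e / 4 * s by rewrite ler_pM2r.
have as2 : 0 <= a * (a * s) by rewrite !mulr_ge0// ltW.
have -> : (1 - a) * ((1 - a) * s) = s - 2 * (a * s) + a * (a * s) by ring.
lra.
Unshelve. all: end_near. Qed.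

End log_tail_cvg.

(** * Back to the random variables *)

Section product_of_independent.
Context {d : measure_display} {T : measurableType d} {R : realType}.
Variables (P : probability T R) (Y1 Y2 : {RV P >-> R}).
Hypotheses (hY1 : forall w, 0 < Y1 w) (hY2 : forall w, 0 < Y2 w).
Hypothesis hind : indep2 P Y1 Y2.
Local Notation t1 := (tailP P Y1).
Local Notation t2 := (tailP P Y2).
Implicit Types (A B : set T) (u v x y : R).

Let pr A : R := fine (P A).

Lemma pr_ge0 A : 0 <= pr A.
Proof. by apply: fine_ge0; exact: measure_ge0. Qed.

Lemma pr_le A B : measurable A -> measurable B -> A `<=` B -> pr A <= pr B.
Proof.
move=> mA mB AB; apply: fine_le; rewrite ?fin_num_measure//.
by apply: le_measure; rewrite ?inE.
Qed.

Lemma pr_setID A B : measurable A -> measurable B -> pr A = pr (A `&` B) + pr (A `&` ~` B).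
Proof.
move=> mA mB; have mC : measurable (~` B) by exact: measurableC.
rewrite /pr -fineD ?fin_num_measure//; try exact: measurableI.
rewrite -measureU; try exact: measurableI.
  by rewrite -setIUr setUv setIT.
by rewrite setIACA setICr setI0.
Qed.

Lemma measurable_tail (X : {RV P >-> R}) x : measurable [set w | x < X w].
Proof.
rewrite (_ : [set w | _] = X @^-1` `]x, +oo[%classic); last first.
  by apply/seteqP; split => w /=; rewrite in_itv/= andbT.
rewrite -[X in measurable X]setTI.
by apply: (measurable_funPT X).
Qed.

Lemma measurable_prod_tail u : measurable [set w | u < Y1 w * Y2 w].
Proof.
rewrite (_ : [set w | _] = (fun w => Y1 w * Y2 w) @^-1` `]u, +oo[%classic); last first.
  by apply/seteqP; split => w /=; rewrite in_itv/= andbT.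
rewrite -[X in measurable X]setTI.
have mf : measurable_fun setT (fun w => Y1 w * Y2 w).
  by apply: measurable_funM; exact: measurable_funPT.
exact: mf.
Qed.

Lemma tailP_ge0 (X : T -> R) x : 0 <= tailP P X x.
Proof. exact: pr_ge0. Qed.

Lemma tailP_le (X : {RV P >-> R}) x y : x <= y -> tailP P X y <= tailP P X x.
Proof.
move=> xy; apply: pr_le; try exact: measurable_tail.
by move=> w /=; exact: le_lt_trans.
Qed.

Lemma pr_indep (A B : set R) : measurable A -> measurable B ->
  pr (Y1 @^-1` A `&` Y2 @^-1` B) = pr (Y1 @^-1` A) * pr (Y2 @^-1` B).
Proof.
move=> mA mB; rewrite /pr hind// fineM ?fin_num_measure//.
  by rewrite -[X in measurable X]setTI; apply: (measurable_funPT Y1).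
by rewrite -[X in measurable X]setTI; apply: (measurable_funPT Y2).
Qed.

Lemma pr_slab v x y : x <= y ->
  pr ([set w | v < Y1 w] `&` [set w | x < Y2 w <= y]) = (t2 x - t2 y) * t1 v.
Proof.
move=> xy.
have h : t2 x = t2 y + pr [set w | x < Y2 w <= y].
  rewrite /tailP -/(pr _) (@pr_setID _ [set w | y < Y2 w]); try exact: measurable_tail.
  congr (pr _ + pr _).
    by apply/seteqP; split => [w []//|w /= yY]; split => //=; exact: le_lt_trans yY.
  apply/seteqP; split => [w [/= -> /negP]|w /= /andP[-> yY]]; first by rewrite -leNgt.
  by split => //; apply/negP; rewrite -leNgt.
rewrite h addrAC subrr add0r mulrC.
have := pr_indep `]v, +oo[%classic `]x, y]%classic.
rewrite (_ : Y1 @^-1` _ = [set w | v < Y1 w]); last first.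
  by apply/seteqP; split => w /=; rewrite in_itv/= andbT.
rewrite (_ : Y2 @^-1` _ = [set w | x < Y2 w <= y]); last first.
  by apply/seteqP; split => w /=; rewrite in_itv.
by apply.
Qed.

Definition joint_tail u y : R := pr ([set w | u < Y1 w * Y2 w] `&` [set w | y < Y2 w]).

Let mI A B : measurable A -> measurable B -> measurable (A `&` B) := @measurableI _ _ A B.

Lemma measurable_slab x y : measurable [set w | x < Y2 w <= y].
Proof.
rewrite (_ : [set w | _] = [set w | x < Y2 w] `&` ~` [set w | y < Y2 w]).
  by apply: measurableI; [|apply: measurableC]; exact: measurable_tail.
apply/seteqP; split => [w /= /andP[xY yY]|w /= [-> /negP]]; last by rewrite -leNgt.
by split => //; apply/negP; rewrite -leNgt.
Qed.

Lemma joint_tailB u x y : x <= y -> joint_tail u x - joint_tail u y =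
  pr ([set w | u < Y1 w * Y2 w] `&` [set w | x < Y2 w <= y]).
Proof.
move=> xy; rewrite /joint_tail (@pr_setID (_ `&` [set w | x < Y2 w]) [set w | y < Y2 w]).
- rewrite (_ : _ `&` _ `&` [set w | y < Y2 w] =
    [set w | u < Y1 w * Y2 w] `&` [set w | y < Y2 w]); last first.
    by apply/seteqP; split => [w /= [[]]//|w /= [uY yY]]; split => //; split => //; exact:
      le_lt_trans yY.
  rewrite addrAC subrr add0r; congr (pr _).
  apply/seteqP; split => [w /= [[uY ->] /negP]|w /= [uY /andP[-> yY]]]; first by rewrite -leNgt.
  by split => //; apply/negP; rewrite -leNgt.
- by apply: mI; [exact: measurable_prod_tail|exact: measurable_tail].
- exact: measurable_tail.
Qed.

(** On the slab [x < Y2 <= y], [Y1 > u / x] forces [Y1 Y2 > u], which in turn forces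
    [Y1 > u / y]. *)
Lemma joint_tail_slab u x y : 0 < x -> x <= y ->
  (t2 x - t2 y) * t1 (u / x) <= joint_tail u x - joint_tail u y <= (t2 x - t2 y) * t1 (u / y).
Proof.
move=> x0 xy; have y0 := lt_le_trans x0 xy.
rewrite joint_tailB// -!pr_slab//; apply/andP; split; apply: pr_le;
  try by apply: mI; [exact: measurable_prod_tail|exact: measurable_slab].
- by apply: mI; [exact: measurable_tail|exact: measurable_slab].
- move=> w /= [uY /andP[xY yY]]; split; last by rewrite xY.
  rewrite ltr_pdivrMr// in uY; apply: (lt_trans uY).
  by rewrite ltr_pM2l.
- by apply: mI; [exact: measurable_tail|exact: measurable_slab].
- move=> w /= [uY /andP[xY yY]]; split; last by rewrite xY.
  rewrite ltr_pdivrMr//; apply: (lt_le_trans uY).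
  by rewrite ler_pM2l.
Qed.

Lemma joint_tail_bounds u y : 0 <= joint_tail u y <= t2 y.
Proof.
rewrite pr_ge0/=; apply: pr_le => //.
- by apply: mI; [exact: measurable_prod_tail|exact: measurable_tail].
- exact: measurable_tail.
Qed.

Lemma prod_tailB u y : 0 < y ->
  0 <= tailP P (fun w => Y1 w * Y2 w) u - joint_tail u y <= t1 (u / y).
Proof.
move=> y0; rewrite /tailP -/(pr _) (@pr_setID _ [set w | y < Y2 w]); last 2 first.
- exact: measurable_prod_tail.
- exact: measurable_tail.
rewrite addrAC subrr add0r pr_ge0/=; apply: pr_le.
- apply: mI; [exact: measurable_prod_tail|apply: measurableC; exact: measurable_tail].
- exact: measurable_tail.
- move=> w /= [uY /negP]; rewrite -leNgt => yY.
  rewrite ltr_pdivrMr//; apply: (lt_le_trans uY); by rewrite ler_pM2l.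
Qed.

Lemma prod_tail_ge u y : 0 < y ->
  t2 y * t1 (u / y) <= tailP P (fun w => Y1 w * Y2 w) u.
Proof.
move=> y0; rewrite mulrC.
have := pr_indep `]u / y, +oo[%classic `]y, +oo[%classic.
rewrite (_ : Y1 @^-1` _ = [set w | u / y < Y1 w]); last first.
  by apply/seteqP; split => w /=; rewrite in_itv/= andbT.
rewrite (_ : Y2 @^-1` _ = [set w | y < Y2 w]); last first.
  by apply/seteqP; split => w /=; rewrite in_itv/= andbT.
move=> <-//; apply: pr_le.
- by apply: mI; exact: measurable_tail.
- exact: measurable_prod_tail.
- move=> w /= [uY yY]; rewrite ltr_pdivrMr// in uY; apply: (lt_trans uY).
  by rewrite ltr_pM2l.
Qed.

End product_of_independent.

(** * The change of variable [v = L * u ^ p] on tails *)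

Section rescaling.
Context {R : realType}.
Implicit Types (L p u v : R) (t g : R -> R).

(* The maximum keeps [rescale L p t] monotone on negative arguments, where [powR]
   would take the constant value 1. *)
Definition rescale L p t v := t ((Num.max v 0 / L) `^ p^-1).

Lemma cvgry_powR p : 0 < p -> x `^ p @[x --> +oo] --> (+oo : set_system R).
Proof.
move=> p0; apply/cvgryPge => A; near=> x.
have x1 : Num.max A 1 `^ p^-1 <= x by near: x; apply: nbhs_pinfty_ge; rewrite num_real.
apply: (@le_trans _ _ (Num.max A 1)); first by rewrite le_max lexx.
have m0 : 0 <= Num.max A 1 by rewrite le_max ler01 orbT.
rewrite -[leLHS](powRr1 m0) -(mulVf (lt0r_neq0 p0)) powRrM.
by apply: ge0_ler_powR; rewrite ?nnegrE ?powR_ge0// ?(ltW p0)// (le_trans _ x1)// powR_ge0.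
Unshelve. all: end_near. Qed.

Lemma rescaleE L p t u : 0 < L -> 0 < p -> 0 < u -> rescale L p t (L * u `^ p) = t u.
Proof.
move=> L0 p0 u0; rewrite /rescale max_l ?mulr_ge0 ?powR_ge0 ?(ltW L0)//.
by rewrite mulrAC divff ?gt_eqF// mul1r -powRrM divff ?gt_eqF// powRr1// ltW.
Qed.

Lemma rescale_pos L p t v : 0 < v -> rescale L p t v = t ((v / L) `^ p^-1).
Proof. by move=> v0; rewrite /rescale max_l// ltW. Qed.

Lemma rescale_le L p t : 0 < L -> 0 < p -> (forall x y, x <= y -> t y <= t x) ->
  forall x y, x <= y -> rescale L p t y <= rescale L p t x.
Proof.
move=> L0 p0 ht x y xy; apply: ht.
apply: ge0_ler_powR; rewrite ?invr_ge0 ?(ltW p0)// ?nnegrE.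
- by rewrite divr_ge0 ?(ltW L0)// le_max lexx orbT.
- by rewrite divr_ge0 ?(ltW L0)// le_max lexx orbT.
- by rewrite ler_pM2r ?invr_gt0// ge_max !le_max xy lexx orbT.
Qed.

Lemma cvgry_root L p : 0 < L -> 0 < p -> (v / L) `^ p^-1 @[v --> +oo] --> (+oo : set_system R).
Proof.
move=> L0 p0; have h1 : v / L @[v --> +oo] --> (+oo : set_system R).
  by move=> Q HQ; apply: (near_pinfty_scale L^-1 Q); rewrite ?invr_gt0.
have h2 := @cvgry_powR p^-1; rewrite invr_gt0 in h2.
exact: (cvg_comp _ _ h1 (h2 p0)).
Qed.

Lemma root_powR L p v : 0 < L -> 0 < p -> 0 < v -> ((v / L) `^ p^-1) `^ p = v / L.
Proof. by move=> L0 p0 v0; rewrite -powRrM mulVf ?gt_eqF// powRr1// divr_ge0// ltW. Qed.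

Lemma rescale_log L p t : 0 < L -> 0 < p ->
  ln (t u) / u `^ p @[u --> +oo] --> - L ->
  ln (rescale L p t v) / v @[v --> +oo] --> (- 1 : R).
Proof.
move=> L0 p0 ht.
have := cvg_comp _ (fun u => ln (t u) / u `^ p) (cvgry_root _ _ L0 p0) ht => h1.
have h2 : ln (t ((v / L) `^ p^-1)) / ((v / L) `^ p^-1) `^ p * L^-1 @[v --> +oo] --> - L * L^-1.
  by apply: cvgM; [exact: h1|exact: cvg_cst].
rewrite mulNr divff ?gt_eqF// in h2; apply: cvg_trans h2; apply: near_eq_cvg; near=> v.
have v0 : 0 < v by near: v; apply: nbhs_pinfty_gt; rewrite num_real.
by rewrite rescale_pos// root_powR//; field; rewrite !gt_eqF.
Unshelve. all: end_near. Qed.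

Lemma asym_equiv_ln (f h : R -> R) e : asym_equiv f h -> 0 < e ->
  (\forall u \near +oo, 0 < h u) -> \forall u \near +oo, 0 < f u /\ `|ln (f u) - ln (h u)| <= e.
Proof.
move=> fh e0 h0.
have h1 : ln (f u / h u) @[u --> +oo] --> ln (1 : R).
  by apply: (cvg_comp _ (@ln R) fh); exact: continuous_ln.
have f1 : \forall u \near +oo, 0 < f u / h u by exact: (cvgr_gt _ fh _ ltr01).
move/cvgrPdist_le: h1 => /(_ e e0); rewrite ln1 => h1; near=> u.
have hu : 0 < h u by near: u.
have fhu : 0 < f u / h u by near: u.
have fu : 0 < f u by rewrite -(divfK (lt0r_neq0 hu) (f u)) mulr_gt0.
split => //; rewrite -ln_div ?posrE// -normrN -[X in `|X|]sub0r; near: u; exact: h1.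
Unshelve. all: end_near. Qed.

Lemma regularly_varying_pos g : regularly_varying g -> \forall u \near +oo, 0 < g u.
Proof.
by move=> [_ [[x0 H] _]]; near=> u; apply: H; near: u; apply: nbhs_pinfty_gt; rewrite num_real.
Unshelve. all: end_near. Qed.

(** [elog] of the rescaled tail is within [e / 4] of [ln g] at the root of [v / L], and taking the
    root multiplies [ln (y / x)] by [p^-1], so the slope becomes [b / p]. *)
Lemma rescale_potter L p t g : 0 < L -> 0 < p -> regularly_varying g ->
  asym_equiv t (fun u => g u * expR (- (L * u `^ p))) -> potter (elog (rescale L p t)).
Proof.
move=> L0 p0 rg tg; have [b b0 H] := regularly_varying_potter _ rg.
exists (b / p); first by rewrite divr_ge0// ltW.
move=> e e0; have e40 : 0 < e / 4 by rewrite divr_gt0.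
have [x0 x00 Hx0] := H _ e40; have g0 := regularly_varying_pos _ rg.
have h0 : \forall u \near +oo, 0 < g u * expR (- (L * u `^ p)).
  by apply: filterS g0 => u gu; rewrite mulr_gt0// expR_gt0.
have H1 := asym_equiv_ln _ _ _ tg e40 h0.
have : \forall u \near +oo, x0 <= u /\ (0 < g u /\
    `|ln (t u) - ln (g u * expR (- (L * u `^ p)))| <= e / 4).
  apply: filterI; first by apply: nbhs_pinfty_ge; rewrite num_real.
  by apply: filterI => //; apply: filterS H1 => u [].
move=> /(cvgry_root _ _ L0 p0) [x1 [_ Hx1]].
exists (Num.max (x1 + 1) 1); first by rewrite lt_max ltr01 orbT.
move=> x y; rewrite ge_max => /andP[xx1 x1x] xy.
have xp : 0 < x by rewrite (lt_le_trans _ x1x).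
have yp := lt_le_trans xp xy.
have [|ux [gx hx]] := Hx1 x; first by rewrite (lt_le_trans _ xx1)// ltrDl.
have [|uy [gy hy]] := Hx1 y; first by rewrite (lt_le_trans _ xy)// (lt_le_trans _ xx1)// ltrDl.
have uxy : (x / L) `^ p^-1 <= (y / L) `^ p^-1.
  apply: ge0_ler_powR; rewrite ?invr_ge0 ?(ltW p0)// ?nnegrE ?divr_ge0 ?(ltW L0) ?(ltW xp)
    ?(ltW yp)//.
  by rewrite ler_pM2r ?invr_gt0.
have := Hx0 _ _ ux uxy.
have key (v : R) : 0 < v -> 0 < g ((v / L) `^ p^-1) ->
    `|ln (t ((v / L) `^ p^-1)) - ln (g ((v / L) `^ p^-1) * expR (- (L * ((v / L) `^ p^-1) `^
      p)))| <= e / 4 ->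
    `|elog (rescale L p t) v - ln (g ((v / L) `^ p^-1))| <= e / 4.
  move=> v0 gv; have -> : L * ((v / L) `^ p^-1) `^ p = v.
    by rewrite root_powR// mulrC divfK// gt_eqF.
  rewrite lnM ?posrE ?expR_gt0// expRK /elog rescale_pos//.
  by rewrite opprD opprK addrA addrAC.
have {}hx := key _ xp gx hx; have {}hy := key _ yp gy hy; move: hx hy.
have -> : ln ((y / L) `^ p^-1 / (x / L) `^ p^-1) = p^-1 * ln (y / x).
  rewrite ln_div ?posrE ?powR_gt0 ?divr_gt0// !ln_powR -mulrBr -ln_div ?posrE ?divr_gt0//.
  by congr (_ * ln _); field; rewrite !gt_eqF.
rewrite (mulrA b) !ler_norml => /andP[? ?] /andP[? ?] /andP[? ?].
by apply/andP; split; lra.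
Qed.

Lemma pos_of_near t : (forall x, 0 <= t x) -> (forall x y, x <= y -> t y <= t x) ->
  (\forall u \near +oo, t u != 0) -> forall x, 0 < t x.
Proof.
move=> t0 tle tn x; have : \forall u \near +oo, x <= u /\ t u != 0.
  by apply: filterI => //; apply: nbhs_pinfty_ge; rewrite num_real.
move=> /filter_ex[u [xu tu]]; apply: lt_le_trans (tle _ _ xu).
by rewrite lt_def tu t0.
Qed.

(** By the convention [ln 0 = 0], a vanishing tail would give the quotient 0, which stays away from
    [- L]. *)
Lemma near_neq0_log L p t : 0 < L -> ln (t u) / u `^ p @[u --> +oo] --> - L ->
  \forall u \near +oo, t u != 0.
Proof.
move=> L0 ht; have L0' : - L < 0 by rewrite oppr_lt0.
have : \forall u \near +oo, ln (t u) / u `^ p < 0 by exact: (cvgr_lt _ ht _ L0').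
apply: filterS => u; apply: contraTneq => ->.
by rewrite ln0// mul0r ltxx.
Qed.

Lemma near_neq0_asym t (h : R -> R) : asym_equiv t h -> \forall u \near +oo, t u != 0.
Proof.
move=> th; have : \forall u \near +oo, 0 < t u / h u by exact: (cvgr_gt _ th _ ltr01).
apply: filterS => u; apply: contraTneq => ->.
by rewrite mul0r ltxx.
Qed.
End rescaling.

(** * The constants [A], [B], [D] and the final assembly *)

Section constants.
Context {R : realType}.
Variables L1 L2 p1 p2 : R.
Hypotheses (hL1 : 0 < L1) (hL2 : 0 < L2) (hp1 : 0 < p1) (hp2 : 0 < p2).
Implicit Types u s x y : R.

Let lam := p2 / (p1 + p2).
Let mu := p1 / (p1 + p2).
Let A := ((p1 * L1) / (p2 * L2)) `^ (1 / (p1 + p2)).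
Let B := L1 * A `^ (- p1) + L2 * A `^ p2.
Let q := p1 * p2 / (p1 + p2).
Let c u := A * u `^ mu.

Let hp : 0 < p1 + p2. Proof. exact: addr_gt0. Qed.
Let lam0 : 0 < lam. Proof. exact: divr_gt0. Qed.
Let mu0 : 0 < mu. Proof. exact: divr_gt0. Qed.
Let lammu : lam + mu = 1.
Proof. by rewrite /lam /mu -mulrDl [p2 + _]addrC divff ?gt_eqF. Qed.
Let A0 : 0 < A. Proof. by rewrite powR_gt0// divr_gt0// mulr_gt0. Qed.
Let B0 : 0 < B. Proof. by rewrite addr_gt0// mulr_gt0// powR_gt0. Qed.
Let q0 : 0 < q. Proof. by rewrite divr_gt0// mulr_gt0. Qed.

(** The critical point equation of [L1 * x ^ (- p1) + L2 * x ^ p2], of which [B] is the value at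
    [A]. It splits [B] in the proportions [lam] and [mu]. *)
Lemma balance : p1 * (L1 * A `^ (- p1)) = p2 * (L2 * A `^ p2).
Proof.
have -> : A `^ p2 = (p1 * L1) / (p2 * L2) * A `^ (- p1).
  have -> : p2 = (p1 + p2) + - p1 by ring.
  rewrite powRD; last by rewrite (gt_eqF A0) implybT.
  congr (_ * _); rewrite addrAC subrr add0r /A -powRrM div1r mulVf ?gt_eqF// powRr1//.
  by rewrite divr_ge0// mulr_ge0// ltW.
by field; rewrite !gt_eqF.
Qed.

Lemma lamB : L1 * A `^ (- p1) = lam * B.
Proof.
have := balance; rewrite /lam /B; set X := L1 * _; set Y := L2 * _ => H.
by rewrite mulrAC mulrDr -H -mulrDl [p2 + _]addrC mulrAC divff ?gt_eqF// mul1r.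
Qed.

Lemma muB : L2 * A `^ p2 = mu * B.
Proof.
have := balance; rewrite /mu /B; set X := L1 * _; set Y := L2 * _ => H.
by rewrite mulrAC mulrDr H -mulrDl [p2 + _]addrC mulrAC divff ?gt_eqF// mul1r.
Qed.

Lemma c_gt0 u : 0 < u -> 0 < c u.
Proof. by move=> u0; rewrite mulr_gt0// powR_gt0. Qed.

Lemma ratio_c u : 0 < u -> u / c u = A^-1 * u `^ lam.
Proof.
move=> u0; have um := powR_gt0 mu u0.
have h : u = u `^ lam * u `^ mu.
  by rewrite -powRD ?(gt_eqF u0) ?implybT// lammu powRr1// ltW.
by rewrite /c {1}h; field; rewrite !gt_eqF.
Qed.

Lemma L1_ratio u : 0 < u -> L1 * (u / c u) `^ p1 = B * u `^ q * lam.
Proof.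
move=> u0; rewrite ratio_c// powRM ?invr_ge0 ?(ltW A0) ?powR_ge0//.
rewrite -(powR_inv1 (ltW A0)) -(powRrM A) -(powRrM u) mulN1r mulrA lamB.
have -> : lam * p1 = q by rewrite /lam /q; field; rewrite gt_eqF.
by ring.
Qed.

Lemma L2_c u : 0 < u -> L2 * (c u) `^ p2 = B * u `^ q * mu.
Proof.
move=> u0; rewrite powRM ?(ltW A0) ?powR_ge0// -(powRrM u) mulrA muB.
have -> : mu * p2 = q by rewrite /mu /q; field; rewrite gt_eqF.
by ring.
Qed.

(** The curve [Y1 Y2 = u] is the level curve. Both sides are expressed relatively to the optimal
    pair [(u / c u, c u)], and [mu / lam = p1 / p2] matches the exponents. *)
Lemma threshold_powR u y : 0 < u -> 0 < y ->
  threshold lam mu (B * u `^ q) (L2 * y `^ p2) = L1 * (u / y) `^ p1.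
Proof.
move=> u0 y0; have cu := c_gt0 _ u0; have uq := powR_gt0 q u0.
have -> : u / y = (u / c u) * (y / c u)^-1 by field; rewrite !gt_eqF.
have yc0 : 0 <= y / c u by rewrite divr_ge0// ltW.
have uc0 : 0 <= u / c u by rewrite divr_ge0// ltW.
rewrite powRM ?invr_ge0// mulrA L1_ratio// -(powR_inv1 yc0) -powRrM mulN1r.
rewrite /threshold /level mulrA; congr (_ * _).
have -> : L2 * y `^ p2 / (B * u `^ q) / mu = (y / c u) `^ p2.
  have -> : L2 * y `^ p2 / (B * u `^ q) / mu = L2 * y `^ p2 / (B * u `^ q * mu).
    by field; rewrite !gt_eqF.
  rewrite -L2_c// powRM ?invr_ge0 ?(ltW y0) ?(ltW cu)//.
  rewrite -(powR_inv1 (ltW cu)) -powRrM mulN1r powRN.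
  by field; rewrite !gt_eqF ?powR_gt0.
rewrite -powRrM; congr (_ `^ _); rewrite /mu /lam; field; by rewrite !gt_eqF.
Qed.

(** The powers of [A] are weighted geometric means of the same two numbers; taking logarithms makes
    the identity linear. *)
Lemma peak_const :
  (p1 * L1) `^ (p2 / (p1 + p2)) * (p2 * L2) `^ (p1 / (p1 + p2)) = p1 * (lam * B).
Proof.
have a0 : 0 < p1 * L1 by rewrite mulr_gt0.
have b0 : 0 < p2 * L2 by rewrite mulr_gt0.
rewrite -lamB mulrA; have pa := powR_gt0 (p2 / (p1 + p2)) a0.
have pb := powR_gt0 (p1 / (p1 + p2)) b0; have pA := powR_gt0 (- p1) A0.
apply: ln_inj; rewrite ?posrE; [exact: mulr_gt0|exact: mulr_gt0|].
rewrite (lnM pa pb) (lnM a0 pA) !ln_powR (ln_div a0 b0).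
by field; rewrite gt_eqF.
Qed.

(** Under the root, [p1 * lam * B / (p1 + p2)] is [lam * mu * B]: both sides are the root of
    [2 pi lam mu s], with [s = B * u ^ q]. *)
Lemma prefactor u : 0 < u ->
  ((2 * pi * (p1 * L1) `^ (p2 / (p1 + p2)) * (p2 * L2) `^ (p1 / (p1 + p2))) / (p1 + p2)) `^ (1 / 2)
  * u `^ (q / 2) = Num.sqrt (B * u `^ q) * (kap lam mu * Num.sqrt pi).
Proof.
move=> u0; rewrite -(mulrA (2 * pi)) peak_const div1r powRrM.
have pi0 := @pi_ge0 R; have uq := powR_ge0 u q.
have K0 : 0 <= 2 * pi * (p1 * (lam * B)) / (p1 + p2).
  apply: divr_ge0; last exact: ltW.
  apply: mulr_ge0; first exact: mulr_ge0.
  exact: mulr_ge0 (ltW hp1) (mulr_ge0 (ltW lam0) (ltW B0)).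
have lm0 : 0 <= 2 * lam * mu.
  exact: mulr_ge0 (mulr_ge0 (ler0n _ _) (ltW lam0)) (ltW mu0).
have Bu0 : 0 <= B * u `^ q by exact: mulr_ge0 (ltW B0) uq.
rewrite (powR12_sqrt K0) (powR12_sqrt uq) -(sqrtrM _ K0) /kap -(sqrtrM _ lm0) -(sqrtrM _ Bu0).
by congr Num.sqrt; rewrite /mu; field; rewrite gt_eqF.
Qed.

Lemma cvgry_mull (a p : R) : 0 < a -> 0 < p ->
  a * u `^ p @[u --> +oo] --> (+oo : set_system R).
Proof.
move=> a0 p0; have h : a * x @[x --> +oo] --> (+oo : set_system R).
  move=> Q HQ; have := near_pinfty_scale a Q a0 HQ.
  by apply: filterS => x; rewrite mulrC.
exact: (cvg_comp _ _ (cvgry_powR _ p0) h).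
Qed.

Lemma cvgry_c : c u @[u --> +oo] --> (+oo : set_system R).
Proof. exact: cvgry_mull. Qed.

Lemma cvgry_ratio_c : u / c u @[u --> +oo] --> (+oo : set_system R).
Proof.
have h : A^-1 * u `^ lam @[u --> +oo] --> (+oo : set_system R).
  by apply: cvgry_mull; rewrite ?invr_gt0.
apply: cvg_trans h; apply: near_eq_cvg; near=> u.
by rewrite ratio_c//; near: u; apply: nbhs_pinfty_gt; rewrite num_real.
Unshelve. all: end_near. Qed.

Lemma cvgry_exponent : B * u `^ q @[u --> +oo] --> (+oo : set_system R).
Proof. exact: cvgry_mull. Qed.

Section with_tails.
Context {d : measure_display} {T : measurableType d}.
Variables (P : probability T R) (Y1 Y2 : {RV P >-> R}).
Hypotheses (hY1 : forall w, 0 < Y1 w) (hY2 : forall w, 0 < Y2 w).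
Hypothesis hind : indep2 P Y1 Y2.
Local Notation t1 := (tailP P Y1).
Local Notation t2 := (tailP P Y2).
Local Notation t := (tailP P (fun w => Y1 w * Y2 w)).

Lemma product_decomposition : tail_decomposition lam mu
  (rescale L1 p1 t1) (rescale L2 p2 t2) (rescale B q t).
Proof.
exists (fun s x => joint_tail P Y1 Y2 ((s / B) `^ q^-1) ((x / L2) `^ p2^-1)) => s s0.
set u := (s / B) `^ q^-1; have u0 : 0 < u by rewrite powR_gt0// divr_gt0.
have su : s = B * u `^ q by rewrite root_powR// mulrC divfK// gt_eqF.
have Gt : rescale B q t s = t u by rewrite rescale_pos.
pose y x := (x / L2) `^ p2^-1.
have y0 x : 0 < x -> 0 < y x by move=> x0; rewrite powR_gt0// divr_gt0.
have r1 x : 0 < x -> rescale L1 p1 t1 (threshold lam mu s x) = t1 (u / y x).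
  move=> x0; have ex : L2 * (y x) `^ p2 = x by rewrite /y root_powR// mulrC divfK// gt_eqF.
  have -> : threshold lam mu s x = L1 * (u / y x) `^ p1 by rewrite -(threshold_powR _ _ u0 (y0
    _ x0)) -su ex.
  by rewrite rescaleE// divr_gt0// y0.
have r2 x : 0 < x -> rescale L2 p2 t2 x = t2 (y x) by move=> x0; rewrite rescale_pos.
have yle x x' : 0 < x -> x <= x' -> y x <= y x'.
  move=> x0 xx'; have x'0 := lt_le_trans x0 xx'.
  apply: ge0_ler_powR; rewrite ?invr_ge0 ?(ltW hp2)// ?nnegrE ?divr_ge0 ?(ltW hL2) ?(ltW x0)
    ?(ltW x'0)//.
  by rewrite ler_pM2r ?invr_gt0.
split=> [x x' x0 xx'|x x0|x x0|x x0].
- have x'0 := lt_le_trans x0 xx'; rewrite !r1// !r2//.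
  by apply: joint_tail_slab => //; [exact: y0|exact: yle].
- by rewrite r2//; exact: joint_tail_bounds.
- by rewrite Gt r1//; apply: prod_tailB => //; exact: y0.
- by rewrite Gt r1// r2//; apply: prod_tail_ge => //; exact: y0.
Qed.

Lemma rough_asymptotics :
  ln (t1 u) / u `^ p1 @[u --> +oo] --> - L1 ->
  ln (t2 u) / u `^ p2 @[u --> +oo] --> - L2 ->
  ln (t u) / u `^ q @[u --> +oo] --> - B.
Proof.
move=> h1 h2.
have T1_gt0 := pos_of_near _ (tailP_ge0 P Y1) (tailP_le P Y1) (near_neq0_log _ _ _ hL1 h1).
have T2_gt0 := pos_of_near _ (tailP_ge0 P Y2) (tailP_le P Y2) (near_neq0_log _ _ _ hL2 h2).
have R1 x : 0 < rescale L1 p1 t1 x by exact: T1_gt0.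
have R2 x : 0 < rescale L2 p2 t2 x by exact: T2_gt0.
have := log_tail_cvg _ _ lam0 mu0 lammu _ _ _ R1 R2
  product_decomposition (rescale_log _ _ _ hL1 hp1 h1) (rescale_log _ _ _ hL2 hp2 h2).
move=> /(cvg_comp _ _ cvgry_exponent) h.
have h3 : ln (rescale B q t (B * u `^ q)) / (B * u `^ q) * B @[u --> +oo] --> - 1 * B.
  by apply: cvgM; [exact: h|exact: cvg_cst].
rewrite mulN1r in h3; apply: cvg_trans h3; apply: near_eq_cvg; near=> u.
have u0 : 0 < u by near: u; apply: nbhs_pinfty_gt; rewrite num_real.
by rewrite rescaleE//; field; rewrite !gt_eqF// powR_gt0.
Unshelve. all: end_near. Qed.

Section precise.
Variables g1 g2 : R -> R.
Hypotheses (rg1 : regularly_varying g1) (rg2 : regularly_varying g2).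
Hypothesis tg1 : asym_equiv t1 (fun u => g1 u * expR (- (L1 * u `^ p1))).
Hypothesis tg2 : asym_equiv t2 (fun u => g2 u * expR (- (L2 * u `^ p2))).

Let T1_gt0 := pos_of_near _ (tailP_ge0 P Y1) (tailP_le P Y1) (near_neq0_asym _ _ tg1).
Let T2_gt0 := pos_of_near _ (tailP_ge0 P Y2) (tailP_le P Y2) (near_neq0_asym _ _ tg2).

Lemma precise_asymptotics :
  t u / (t1 (u / c u) * t2 (c u)) / Num.sqrt (B * u `^ q) @[u --> +oo]
    --> kap lam mu * Num.sqrt pi.
Proof.
have R1 x : 0 < rescale L1 p1 t1 x by exact: T1_gt0.
have R2 x : 0 < rescale L2 p2 t2 x by exact: T2_gt0.
have := tail_ratio_cvg _ _ lam0 mu0 lammu _ _ R1 R2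
  (rescale_le _ _ _ hL1 hp1 (tailP_le P Y1)) (rescale_le _ _ _ hL2 hp2 (tailP_le P Y2))
  (rescale_potter _ _ _ _ hL1 hp1 rg1 tg1) (rescale_potter _ _ _ _ hL2 hp2 rg2 tg2)
  _ product_decomposition.
move=> /(cvg_comp _ _ cvgry_exponent) h; apply: cvg_trans h; apply: near_eq_cvg; near=> u.
have u0 : 0 < u by near: u; apply: nbhs_pinfty_gt; rewrite num_real.
have cu := c_gt0 _ u0.
rewrite /= /peak -L1_ratio// -L2_c// (rescaleE _ _ _ _ hL1 hp1) ?divr_gt0//.
by rewrite (rescaleE _ _ _ _ hL2 hp2 cu) (rescaleE _ _ _ _ B0 q0 u0).
Unshelve. all: end_near. Qed.

Let D := ((2 * pi * (p1 * L1) `^ (p2 / (p1 + p2)) * (p2 * L2) `^ (p1 / (p1 + p2)))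
  / (p1 + p2)) `^ (1 / 2).

Lemma tail_equiv_tails :
  asym_equiv t (fun u => D * u `^ (q / 2) * t1 (u / c u) * t2 (c u)).
Proof.
have k0 : 0 < kap lam mu * Num.sqrt pi.
  by rewrite mulr_gt0 ?kap_gt0// sqrtr_gt0 pi_gt0.
have h : t u / (t1 (u / c u) * t2 (c u)) / Num.sqrt (B * u `^ q) / (kap lam mu * Num.sqrt pi)
    @[u --> +oo] --> kap lam mu * Num.sqrt pi / (kap lam mu * Num.sqrt pi).
  by apply: cvgM; [exact: precise_asymptotics|exact: cvg_cst].
rewrite divff ?gt_eqF// in h; apply: cvg_trans h; apply: near_eq_cvg; near=> u.
have u0 : 0 < u by near: u; apply: nbhs_pinfty_gt; rewrite num_real.
have cu := c_gt0 _ u0; rewrite prefactor// -!mulrA -!invfM.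
by congr (_ / _); ring.
Unshelve. all: end_near. Qed.

(** Both hypotheses are used along arguments tending to infinity, and the exponents [lam * s] and
    [mu * s] add up to [s]. *)
Lemma tails_ratio :
  (t1 (u / c u) * t2 (c u)) / (g1 (u / c u) * g2 (c u) * expR (- (B * u `^ q)))
    @[u --> +oo] --> (1 : R).
Proof.
have h1 := cvg_comp _ _ cvgry_ratio_c tg1; have h2 := cvg_comp _ _ cvgry_c tg2.
have h : t1 (u / c u) / (g1 (u / c u) * expR (- (L1 * (u / c u) `^ p1))) *
    (t2 (c u) / (g2 (c u) * expR (- (L2 * c u `^ p2)))) @[u --> +oo] --> (1 * 1 : R).
  exact: cvgM h1 h2.
rewrite mulr1 in h.
apply: cvg_trans h; apply: near_eq_cvg; near=> u.
have u0 : 0 < u by near: u; apply: nbhs_pinfty_gt; rewrite num_real.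
rewrite L1_ratio// L2_c//.
have -> : expR (- (B * u `^ q)) = expR (- (B * u `^ q * lam)) * expR (- (B * u `^ q * mu)).
  by rewrite -expRD -opprD -mulrDr lammu mulr1.
rewrite mulrACA -invfM; congr (_ / _); ring.
Unshelve. all: end_near. Qed.

Lemma prefactor_gt0 u : 0 < u -> 0 < D * u `^ (q / 2).
Proof.
move=> u0; rewrite mulr_gt0 ?powR_gt0// divr_gt0// !mulr_gt0 ?powR_gt0 ?pi_gt0// mulr_gt0//.
Qed.

Lemma tail_equiv_product : asym_equiv t
  (fun u => D * u `^ (q / 2) * g1 (u / c u) * g2 (c u) * expR (- (B * u `^ q))).
Proof.
have h : t u / (D * u `^ (q / 2) * t1 (u / c u) * t2 (c u)) *
    ((t1 (u / c u) * t2 (c u)) / (g1 (u / c u) * g2 (c u) * expR (- (B * u `^ q))))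
    @[u --> +oo] --> (1 * 1 : R).
  by apply: cvgM; [exact: tail_equiv_tails|exact: tails_ratio].
rewrite mulr1 in h.
apply: cvg_trans h; apply: near_eq_cvg; near=> u.
have u0 : 0 < u by near: u; apply: nbhs_pinfty_gt; rewrite num_real.
have D0 := prefactor_gt0 _ u0; have x1 := T1_gt0 (u / c u); have x2 := T2_gt0 (c u).
have tt0 := mulr_gt0 x1 x2.
set W := g1 _ * g2 _ * expR _; set tt := t1 _ * t2 _ in tt0 *.
have -> : D * u `^ (q / 2) * t1 (u / c u) * t2 (c u) = D * u `^ (q / 2) * tt by rewrite /tt; ring.
have -> : D * u `^ (q / 2) * g1 (u / c u) * g2 (c u) * expR (- (B * u `^ q)) = D * u `^ (q / 2) * W.
  by rewrite /W; ring.
by rewrite mulf_div [_ * tt * W]mulrAC -mulf_div divff ?gt_eqF// mulr1.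
Unshelve. all: end_near. Qed.

Lemma product_equiv_tails : asym_equiv
  (fun u => D * u `^ (q / 2) * g1 (u / c u) * g2 (c u) * expR (- (B * u `^ q)))
  (fun u => D * u `^ (q / 2) * t1 (u / c u) * t2 (c u)).
Proof.
have h : ((t1 (u / c u) * t2 (c u)) / (g1 (u / c u) * g2 (c u) * expR (- (B * u `^ q))))^-1
    @[u --> +oo] --> (1^-1 : R).
  by apply: cvgV; [exact: oner_neq0|exact: tails_ratio].
rewrite invr1 in h.
apply: cvg_trans h; apply: near_eq_cvg; near=> u.
have u0 : 0 < u by near: u; apply: nbhs_pinfty_gt; rewrite num_real.
have D0 := prefactor_gt0 _ u0.
set W := g1 _ * g2 _ * expR _; set tt := t1 _ * t2 _.
have -> : D * u `^ (q / 2) * t1 (u / c u) * t2 (c u) = D * u `^ (q / 2) * tt by rewrite /tt; ring.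
have -> : D * u `^ (q / 2) * g1 (u / c u) * g2 (c u) * expR (- (B * u `^ q)) = D * u `^ (q / 2) * W.
  by rewrite /W; ring.
by rewrite invf_div -[RHS]mulf_div divff ?gt_eqF// mul1r.
Unshelve. all: end_near. Qed.

End precise.
End with_tails.
End constants.

Theorem theorem2p1 (d : measure_display) (T : measurableType d) (R : realType)
  (P : probability T R) (Y1 Y2 : {RV P >-> R})
  (L1 L2 p1 p2 : R)
  (hY1 : forall w, 0 < Y1 w) (hY2 : forall w, 0 < Y2 w)
  (hind : indep2 P Y1 Y2)
  (hL1 : 0 < L1) (hL2 : 0 < L2) (hp1 : 0 < p1) (hp2 : 0 < p2) :
  let A := ((p1 * L1) / (p2 * L2)) `^ (1 / (p1 + p2)) in
  let B := L1 * A `^ (- p1) + L2 * A `^ p2 in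
  let q := p1 * p2 / (p1 + p2) in
  (* (a) *)
  ( ((fun u => ln (tailP P Y1 u) / u `^ p1) @ +oo --> - L1) ->
    ((fun u => ln (tailP P Y2 u) / u `^ p2) @ +oo --> - L2) ->
    (fun u => ln (tailP P (fun w => Y1 w * Y2 w) u) / u `^ q) @ +oo --> - B )
  /\
  (* (b) *)
  ( forall g1 g2 : R -> R,
    regularly_varying g1 -> regularly_varying g2 ->
    asym_equiv (tailP P Y1) (fun u => g1 u * expR (- (L1 * u `^ p1))) ->
    asym_equiv (tailP P Y2) (fun u => g2 u * expR (- (L2 * u `^ p2))) ->
    let c := fun u : R => A * u `^ (p1 / (p1 + p2)) in
    let D := ((2 * pi * (p1 * L1) `^ (p2 / (p1 + p2)) * (p2 * L2) `^ (p1 / (p1 + p2)))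
               / (p1 + p2)) `^ (1 / 2) in
    asym_equiv (tailP P (fun w => Y1 w * Y2 w))
      (fun u => D * u `^ (q / 2) * g1 (u / c u) * g2 (c u) * expR (- (B * u `^ q)))
    /\
    asym_equiv
      (fun u => D * u `^ (q / 2) * g1 (u / c u) * g2 (c u) * expR (- (B * u `^ q)))
      (fun u => D * u `^ (q / 2) * tailP P Y1 (u / c u) * tailP P Y2 (c u)) ).
Proof.
move=> A B q; split; first exact: rough_asymptotics.
move=> g1 g2 rg1 rg2 tg1 tg2 c D; split.
  exact: tail_equiv_product.
exact: product_equiv_tails.
Qed.
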